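(* Let $x\in(0,\infty)$ be such that $0<F(x)<1$. Then, for $m,n\to\infty$ (with no restriction on the relative rates of $m$ and $n$), $$n^{1/2}\left(\hat F^S_{m,n}(x)-\mathbb{E}[\hat F^S_{m,n}(x)]\right)=n^{1/2}\left(\hat F^S_{m,n}(x)-S_m(F;x)\right)\xrightarrow{D}\mathcal{N}\left(0,\sigma^2(x)\right),$$ where $\sigma^2(x)=F(x)(1-F(x))$ and $\xrightarrow{D}$ denotes convergence in distribution.
   Context: Let $X_1,X_2,\dots$ be i.i.d. random variables with values in $[0,\infty)$, with distribution function $F$ ($F(0)=0$) and density $f$. Standing assumption: $F$ is continuous, and the first and second derivatives $f=F'$ and $f'=F''$ of $F$ exist and are continuous and bounded on $[0,\infty)$. The empirical distribution function is $F_n(x)=\frac1n\sum_{i=1}^n \mathbb{I}(X_i\le x)$. For $m\in\mathbb{N}$, $m\geq 1$, $k\in\{0,1,2,\dots\}$ and $x\ge 0$ let $V_{k,m}(x)=e^{-mx}\frac{(mx)^k}{k!}$ (with $0^0=1$). The Szasz-Mirakyan operator of $F$ is $S_m(F;x)=\sum_{k=0}^\infty F\left(\frac km\right)V_{k,m}(x)$ and the Szasz estimator is $\hat F^S_{m,n}(x)=\sum_{k=0}^\infty F_n\left(\frac km\right)V_{k,m}(x)$. Here $m=m_n$ is a sequence depending on $n$ with $m_n\to\infty$ as $n\to\infty$. *)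

(* Defs.v *)
From HB Require Import structures.
From mathcomp Require Import all_boot all_order all_algebra finmap.
From mathcomp Require Import all_classical all_reals all_analysis.

Set Implicit Arguments.
Unset Strict Implicit.
Unset Printing Implicit Defensive.

Import Order.TTheory GRing.Theory Num.Theory.
Import numFieldNormedType.Exports.

Local Open Scope classical_set_scope.
Local Open Scope ring_scope.

Definition mutually_independent d (T : measurableType d) (R : realType)
    (P : probability T R) (I : choiceType) (X : I -> {RV P >-> R}) : Prop :=
  forall (J : {fset I}) (A : I -> set R), (forall i, measurable (A i)) ->
    P (\bigcap_(i in [set` J]) (X i @^-1` A i)) =
    (\prod_(i <- J) P (X i @^-1` A i))%E.

Definition identically_distributed d (T : measurableType d) (R : realType)
    (P : probability T R) (I : Type) (X : I -> {RV P >-> R}) : Prop :=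
  forall (i j : I) (A : set R), measurable A ->
    distribution P (X i) A = distribution P (X j) A.

(* The measurability clause is needed because [P] takes unspecified values on
   nonmeasurable sets. *)
Definition cvg_in_distribution d (T : measurableType d) (R : realType)
    (P : probability T R) (Z : nat -> T -> R)
    (mu : probability (measurableTypeR R) R) : Prop :=
  (forall n, measurable_fun [set: T] (Z n)) /\
  (forall t : R, {for t, continuous (fun r : R => mu `]-oo, r]%classic)} ->
     P (Z n @^-1` `]-oo, t]%classic) @[n --> \oo] --> mu `]-oo, t]%classic).

(* Derivative relative to [D]: one-sided at an endpoint of an interval [D]. *)
Definition has_derivative_within (R : realType) (D : set R) (G : R -> R)
    (x l : R) : Prop :=
  (G y - G x) / (y - x) @[y --> within D x^'] --> l.

Definition szasz_weight (R : realType) (k m : nat) (x : R) : R :=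
  expR (- (m%:R * x)) * ((m%:R * x) ^+ k / k`!%:R).

(* The series converges absolutely when [G] is bounded on the nonnegative
   reals, as distribution functions are; otherwise [limn] may be a default
   value. *)
Definition szasz_operator (R : realType) (m : nat) (G : R -> R) (x : R) : R :=
  limn (series (fun k => G (k%:R / m%:R) * szasz_weight k m x)).

(* [X i] is the [i.+1]-th observation. *)
Definition empirical_cdf (T : Type) (R : realType) (X : nat -> T -> R)
    (n : nat) (w : T) (x : R) : R :=
  n%:R^-1 * \sum_(i < n) \1_(`]-oo, x] : set R) (X i w).

Definition szasz_estimator (T : Type) (R : realType) (X : nat -> T -> R)
    (m n : nat) (x : R) (w : T) : R :=
  szasz_operator m (empirical_cdf X n w) x.

(* Main.v *)
(* The estimator is an average of i.i.d. terms,
   Fhat = n^-1 sum_i g_m(X_i) with g_m(y) = P(Poisson(m x) >= m y), and g_m tends to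
   the indicator of [y <= x] off the point x, which X_i does not charge. The
   normalised difference between Fhat - E Fhat and F_n(x) - F(x) is centred, with
   variance that of g_m(X_1) - 1(X_1 <= x), which tends to 0 at whatever rate m
   grows. It remains to prove the theorem of de Moivre and Laplace for F_n(x).

   That is done without characteristic functions. Let G be the distribution function
   of N(0, s^2), s^2 = p (1 - p). The function u(t, y) = G((a - y) / sqrt t) solves
   the heat equation, so by Taylor's formula one centred Bernoulli step of size
   r = n^(-1/2) maps u(t, .) to u(t + r^2, .) up to C r^3, uniformly for t >= e;
   n steps map u(e, .) to u(e + 1, .) up to C n^(-1/2). As u(e, .) is an
   approximate indicator of the half-line y <= a, letting n tend to infinity and
   then e to 0 gives the convergence of the distribution functions. *)
Require Import Defs.
From HB Require Import structures.
From mathcomp Require Import all_boot all_order all_algebra finmap.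
From mathcomp Require Import all_classical all_reals all_analysis.
From mathcomp Require Import measurable_realfun ring lra.

Set Implicit Arguments.
Unset Strict Implicit.
Unset Printing Implicit Defensive.

Import Order.TTheory GRing.Theory Num.Theory.
Import numFieldNormedType.Exports.

Local Open Scope classical_set_scope.
Local Open Scope ring_scope.

(** * Mean value and Taylor bounds *)

(** The mean value inequality, with the endpoints in either order so that the increments in Taylor's
    formula may have either sign. *)
Lemma is_derive_norm_le (R : realType) (F f : R -> R) (K a b : R) :
  (forall t, a <= t <= b \/ b <= t <= a -> is_derive t 1 F (f t)) ->
  (forall t, a <= t <= b \/ b <= t <= a -> `|f t| <= K) ->
  `|F b - F a| <= K * `|b - a|.
Proof.
wlog ab : a b / a <= b => [hwlog|] dF fK.
  have [ab|/ltW ba] := leP a b; first exact: hwlog.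
  rewrite distrC (distrC b); apply: hwlog => // t ht;
    by [apply: dF; case: ht; [right|left]|apply: fK; case: ht; [right|left]].
have cF : {within `[a, b], continuous F}.
  apply: derivable_within_continuous => t; rewrite in_itv/= => tab.
  have dFt : is_derive t 1 F (f t) by apply: dF; left.
  exact: ex_derive.
have dF' t : t \in `]a, b[ -> is_derive t 1 F (f t).
  by rewrite in_itv/= => /andP[/ltW at_ /ltW tb]; apply: dF; left; rewrite at_ tb.
have [c cab ->] := MVT_segment ab dF' cF.
rewrite normrM ler_wpM2r//; apply: fK; left.
by move: cab; rewrite in_itv.
Qed.

(** The mean value inequality is used twice: on [F1] minus its affine part at [y], then on [F] minus
    its quadratic part. This loses the factor 1/6 of the sharp constant, which does not affect the
    rate. *)
Lemma taylor2_lipschitz (R : realType) (F F1 F2 : R -> R) (C y e : R) :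
  (forall t : R, is_derive t 1 F (F1 t)) -> (forall t : R, is_derive t 1 F1 (F2 t)) ->
  0 <= C -> (forall t, `|F2 t - F2 y| <= C * `|t - y|) ->
  `|F (y + e) - F y - e * F1 y - e ^+ 2 / 2 * F2 y| <= C * `|e| ^+ 3.
Proof.
move=> dF dF1 C0 F2C.
have btw t e' : y <= t <= y + e' \/ y + e' <= t <= y -> `|t - y| <= `|e'|.
  move=> [|] /andP[h1 h2].
    by rewrite !ger0_norm; lra.
  by rewrite !ler0_norm; lra.
have H1 e' : `|F1 (y + e') - F1 y - e' * F2 y| <= C * `|e'| ^+ 2.
  pose g t := F1 t - (t - y) * F2 y.
  have := @is_derive_norm_le _ g (fun t => F2 t - F2 y) (C * `|e'|) y (y + e').
  rewrite /g subrr mul0r subr0 [_ + _ - y]addrAC subrr add0r expr2 mulrA.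
  rewrite [X in `|X| <= _]addrAC; apply.
    move=> t _; apply: is_derive_eq.
    by rewrite /GRing.scale/=; ring.
  move=> t /btw te; apply: (le_trans (F2C t)).
  exact: ler_wpM2l.
pose g t := F t - (t - y) * F1 y - (t - y) ^+ 2 / 2 * F2 y.
have := @is_derive_norm_le _ g (fun t => F1 t - F1 y - (t - y) * F2 y)
  (C * `|e| ^+ 2) y (y + e).
rewrite /g subrr [_ + _ - y]addrAC subrr add0r expr0n/= !mul0r !subr0.
rewrite (_ : _ - F y = F (y + e) - F y - e * F1 y - e ^+ 2 / 2 * F2 y); last by ring.
rewrite (_ : C * `|e| ^+ 2 * `|e| = C * `|e| ^+ 3); last by rewrite -mulrA -exprSr.
apply.
  move=> t _; apply: is_derive_eq.
  by rewrite /GRing.scale/=; field.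
move=> t /btw te; have := H1 (t - y); rewrite addrCA subrr addr0 => /le_trans; apply.
by rewrite ler_wpM2l// lerXn2r// nnegrE.
Qed.

(** * The centred normal law: distribution function, density and tails *)

Definition normal_cdf (R : realType) (s t : R) : R :=
  fine (normal_prob 0 s `]-oo, t]).

Section normal_cdf.
Variables (R : realType) (s : R).
Hypothesis s0 : s != 0.
Local Notation G := (normal_cdf s).
Local Notation g := (normal_pdf 0 s).

Lemma normal_cdfE t : normal_prob 0 s `]-oo, t] = (G t)%:E.
Proof. by rewrite fineK// fin_num_measure. Qed.

Lemma normal_cdf_ge0 t : 0 <= G t.
Proof. by rewrite fine_ge0. Qed.

Lemma normal_cdf_le1 t : G t <= 1.
Proof. by rewrite -lee_fin -normal_cdfE probability_le1. Qed.

Lemma normal_cdf_nd : {homo G : x y / x <= y}.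
Proof.
move=> x y xy; rewrite -lee_fin -!normal_cdfE le_measure ?inE//.
exact: subset_itvl.
Qed.

Lemma is_derive_normal_cdf (t : R) : is_derive t 1 G (g t).
Proof.
have [] := @continuous_FTC1 R g -oo%O t (t + 1).
- by rewrite ltrDl.
- apply: (@integrableS _ _ _ lebesgue_measure setT) => //.
  exact: integrable_normal_pdf.
- by rewrite ltNyr.
- exact: continuous_normal_pdf.
by move=> dG <-; rewrite derive1E; exact: DeriveDef.
Qed.

Lemma continuous_normal_cdf : continuous G.
Proof.
move=> t; apply/differentiable_continuous/derivable1_diffP.
have ? := is_derive_normal_cdf t; exact: ex_derive.
Qed.

Lemma is_derive_normal_pdf (t : R) : is_derive t 1 g (- (t / s ^+ 2) * g t).
Proof.
rewrite normal_pdfE//.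
rewrite (_ : (fun x => _) =
  fun x => normal_peak s * expR (- x ^+ 2 / (s ^+ 2 *+ 2))); last first.
  by apply/funext => x; rewrite /normal_fun subr0.
apply: is_derive_eq; rewrite /normal_fun subr0 /GRing.scale/=; field.
by rewrite s0.
Qed.

(** Under [normal_prob 0 s] the identity is a random variable with distribution function [G], so the
    limits of [G] at infinity are instances of those of any [cdf]. *)
Let idR : measurableTypeR R -> R := idfun.

#[local] HB.instance Definition _ :=
  @isMeasurableFun.Build _ _ _ _ idR (@measurable_id _ _ setT).

Let cdf_idR : cdf (idR : {RV normal_prob 0 s >-> R}) = EFin \o G.
Proof. by apply/funext => t; rewrite /= -normal_cdfE. Qed.

Lemma normal_cdf_cvg0 : G t @[t --> -oo] --> (0 : R).
Proof.
have := cvg_cdfNy0 (idR : {RV normal_prob 0 s >-> R}).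
by rewrite cdf_idR => /fine_cvgP[].
Qed.

Lemma normal_cdf_cvg1 : G t @[t --> +oo] --> (1 : R).
Proof.
have := cvg_cdfy1 (idR : {RV normal_prob 0 s >-> R}).
by rewrite cdf_idR => /fine_cvgP[].
Qed.

(** The higher derivatives of [heat] are polynomials in [z] of degree at most 3 times the density,
    with coefficients depending on [t]; one constant [K] bounds all the monomials. *)
Lemma normal_pdf_decay : exists2 K : R, 0 < K &
  forall (t : R) k, (k <= 4)%N -> `|t| ^+ k * g t <= K.
Proof.
(* The bound rests on |t|^k <= 1 + t^4. With w = t^2 / (2 s^2) one has t^4 = 4 s^4 w^2, and w^2 <= 2
   exp w by the quadratic term of the exponential series; hence 8 s^4. *)
pose K := normal_peak s * (1 + 8 * s ^+ 4).
have s4 : 0 <= s ^+ 4 by rewrite exprn_even_ge0.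
have p0 := normal_peak_gt0 s0.
exists K; first by rewrite mulr_gt0//; lra.
move=> t k k4.
have tk : `|t| ^+ k <= 1 + t ^+ 4.
  have [t1|/ltW t1] := leP `|t| 1.
    rewrite (@le_trans _ _ 1)//; first by rewrite exprn_ile1.
    by rewrite lerDl exprn_even_ge0.
  rewrite (@le_trans _ _ (`|t| ^+ 4))//; first by rewrite ler_weXn2l.
  by rewrite -normrX ger0_norm ?exprn_even_ge0// lerDr.
apply: (le_trans (ler_wpM2r (normal_pdf_ge0 _ _ _) tk)).
rewrite normal_pdfE// mulrCA ler_pM2l// /normal_fun subr0 mulrDl mul1r.
have w0 : 0 <= t ^+ 2 / (s ^+ 2 *+ 2).
  by rewrite divr_ge0 ?mulrn_wge0 ?sqr_ge0.
rewrite mulNr; set w := t ^+ 2 / _ in w0 *.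
have -> : t ^+ 4 = 4 * s ^+ 4 * w ^+ 2 by rewrite /w; field; rewrite s0.
rewrite lerD//; first by rewrite -expR0 ler_expR oppr_le0.
have := expR_ge1Dxn 1 w0; rewrite expRN ler_pdivrMr ?expR_gt0// => h.
have h2 : w ^+ 2 <= 2 * expR w.
  have e0 := expR_gt0 w; have : w ^+ 2 / 2`!%:R <= expR w by lra.
  by rewrite ler_pdivrMr// mulrC.
rewrite (_ : 8 * _ * _ = 4 * s ^+ 4 * (2 * expR w)); last by ring.
by rewrite ler_wpM2l// mulr_ge0.
Qed.

End normal_cdf.

(** * Derivatives of the heat solution in space and time *)

(* A solution of the heat equation [du/dt = s^2/2 d^2u/dy^2], with initial value
   the indicator of [y <= a]. *)
Definition heat (R : realType) (s a t y : R) : R :=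
  normal_cdf s ((a - y) / Num.sqrt t).

Section heat.
Variables (R : realType) (s a : R).
Hypothesis s0 : s != 0.
Local Notation g := (normal_pdf 0 s).
Local Notation z t y := ((a - y) / Num.sqrt t).

(** For [t <= 0] the square root and its inverse are zero, so that [heat] is constant in [y] and the
    formula gives zero as well. *)
Lemma is_derive_heat_space (t y : R) :
  is_derive y 1 (heat s a t) (- (g (z t y) / Num.sqrt t)).
Proof.
have ? := is_derive_normal_cdf s0 (z t y).
rewrite (_ : heat s a t = normal_cdf s \o (fun y => z t y))//.
apply: is_derive_eq; rewrite /GRing.scale/=; ring.
Qed.

Let is_derive_pdf_z (t y : R) : 0 < t ->
  is_derive y 1 (g \o (fun y => z t y)) (z t y / s ^+ 2 * g (z t y) / Num.sqrt t).
Proof.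
move=> t0; have ? := is_derive_normal_pdf s0 (z t y).
apply: is_derive_eq; rewrite /GRing.scale/=; field.
by rewrite s0 sqrtr_eq0 -ltNge t0.
Qed.

Lemma is_derive_heat_space2 (t y : R) : 0 < t ->
  is_derive y 1 (fun y => - (g (z t y) / Num.sqrt t))
    (- (z t y * g (z t y) / (s ^+ 2 * t))).
Proof.
move=> t0; have ? := is_derive_pdf_z y t0.
rewrite (_ : (fun y => _) = (fun x => - ((g \o (fun y => z t y)) x / Num.sqrt t)))//.
apply: is_derive_eq; rewrite /GRing.scale/=.
move: (sqr_sqrtr (ltW t0)) (sqrtr_gt0 t); rewrite t0.
move: (Num.sqrt t) => q <- /gt_eqF q0; field.
by rewrite s0 q0.
Qed.

Lemma is_derive_heat_space3 (t y : R) : 0 < t ->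
  is_derive y 1 (fun y => - (z t y * g (z t y) / (s ^+ 2 * t)))
    ((1 - z t y ^+ 2 / s ^+ 2) * g (z t y) / (s ^+ 2 * (Num.sqrt t * t))).
Proof.
move=> t0; have ? := is_derive_pdf_z y t0.
rewrite (_ : (fun y => _) =
  (fun x => - (z t x * (g \o (fun y => z t y)) x / (s ^+ 2 * t))))//.
apply: is_derive_eq; rewrite /GRing.scale/=; field.
by rewrite s0 sqrtr_eq0 -ltNge t0/= gt_eqF.
Qed.

Let is_derive_z (t y : R) : 0 < t ->
  is_derive t 1 (fun t => z t y) (- (z t y / (2 * t))).
Proof.
move=> t0; have ? := is_derive1_sqrt t0.
have q0 : Num.sqrt t != 0 by rewrite sqrtr_eq0 -ltNge.
have ? : is_derive t 1 (fun t => (Num.sqrt t)^-1)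
    (- (Num.sqrt t) ^- 2 *: (2 * Num.sqrt t)^-1).
  exact: is_deriveV.
apply: is_derive_eq; rewrite /GRing.scale/=.
move: (sqr_sqrtr (ltW t0)) q0; move: (Num.sqrt t) => q <- q0; field.
exact: q0.
Qed.

(** The derivative is [s ^+ 2 / 2] times the one in [is_derive_heat_space2]: this is the heat
    equation. *)
Lemma is_derive_heat_time (t y : R) : 0 < t ->
  is_derive t 1 (fun t => heat s a t y) (- (z t y * g (z t y) / (2 * t))).
Proof.
move=> t0; have ? := is_derive_normal_cdf s0 (z t y).
have ? := is_derive_z y t0.
rewrite (_ : (fun t => _) = normal_cdf s \o (fun t => z t y))//.
apply: is_derive_eq; rewrite /GRing.scale/=; field.
by rewrite sqrtr_eq0 -ltNge t0/= gt_eqF.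
Qed.

Lemma is_derive_heat_time2 (t y : R) : 0 < t ->
  is_derive t 1 (fun t => - (z t y * g (z t y) / (2 * t)))
    ((3 * z t y - z t y ^+ 3 / s ^+ 2) * g (z t y) / (4 * t ^+ 2)).
Proof.
move=> t0; have ? := is_derive_z y t0.
have ? : is_derive t 1 (g \o (fun t => z t y))
    (z t y ^+ 2 / (2 * s ^+ 2 * t) * g (z t y)).
  have ? := is_derive_normal_pdf s0 (z t y).
  apply: is_derive_eq; rewrite /GRing.scale/=; field.
  by rewrite s0 sqrtr_eq0 -ltNge t0/= gt_eqF.
have ? : is_derive t 1 (fun t : R => (2 * t)^-1) (- (2 * t) ^- 2 *: (2 : R)).
  apply: is_deriveV; first by rewrite gt_eqF// mulr_gt0.
  by apply: is_derive_eq; rewrite /GRing.scale/= mulr1.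
rewrite (_ : (fun t => _) =
  (fun x => - (z x y * (g \o (fun t => z t y)) x * (2 * x)^-1)))//.
apply: is_derive_eq; rewrite /GRing.scale/=; field.
by rewrite s0 sqrtr_eq0 -ltNge t0/= gt_eqF.
Qed.

End heat.

(** * Taylor expansions of the heat solution, uniform over times at least [e] *)

Section heat_taylor.
Variables (R : realType) (s a e : R).
Hypotheses (s0 : s != 0) (e0 : 0 < e).
Local Notation g := (normal_pdf 0 s).
Local Notation z t y := ((a - y) / Num.sqrt t).

(** The third space derivative is (1 - z^2 / s^2) g(z) / (s^2 t^(3/2)). The density absorbs the
    powers of z and [e <= t] bounds the denominator from below, so the second derivative is
    Lipschitz with a constant free of [t] and [y]. *)
Lemma heat_space_taylor : exists2 C : R, 0 <= C &
  forall t y h : R, e <= t ->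
    `|heat s a t (y + h) - heat s a t y - h * - (g (z t y) / Num.sqrt t)
      - h ^+ 2 / 2 * - (z t y * g (z t y) / (s ^+ 2 * t))| <= C * `|h| ^+ 3.
Proof.
have [K K0 Kg] := normal_pdf_decay s0.
have s20 : 0 < s ^+ 2 by rewrite exprn_even_gt0.
have D0 : 0 < s ^+ 2 * (Num.sqrt e * e) by rewrite mulr_gt0// mulr_gt0// sqrtr_gt0.
pose C : R := (K + K / s ^+ 2) / (s ^+ 2 * (Num.sqrt e * e)).
have C0 : 0 <= C by rewrite divr_ge0 ?ltW// addr_gt0// divr_gt0.
exists C => // t y h et; have t0 := lt_le_trans e0 et.
apply: (@taylor2_lipschitz _ _ (fun y => - (g (z t y) / Num.sqrt t))
  (fun y => - (z t y * g (z t y) / (s ^+ 2 * t)))) => //.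
- by move=> x; exact: is_derive_heat_space.
- by move=> x; exact: is_derive_heat_space2.
move=> x; apply: (@is_derive_norm_le _
  (fun y => - (z t y * g (z t y) / (s ^+ 2 * t)))
  (fun y => (1 - z t y ^+ 2 / s ^+ 2) * g (z t y) / (s ^+ 2 * (Num.sqrt t * t)))).
  by move=> v _; exact: is_derive_heat_space3.
move=> v _; set w := z t v.
have Dt : s ^+ 2 * (Num.sqrt e * e) <= s ^+ 2 * (Num.sqrt t * t).
  by rewrite ler_pM2l// ler_pM ?sqrtr_ge0 ?(ltW e0) ?ler_wsqrtr.
have Dt0 := lt_le_trans D0 Dt.
rewrite normrM normfV (gtr0_norm Dt0) /C ler_pM//.
- by rewrite invr_ge0 ltW.
- have -> : (1 - w ^+ 2 / s ^+ 2) * g w = `|w| ^+ 0 * g w - `|w| ^+ 2 * g w / s ^+ 2.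
    by rewrite expr0 real_normK ?num_real//; ring.
  rewrite (le_trans (ler_normB _ _))// lerD//.
    by rewrite ger0_norm ?Kg// mulr_ge0 ?normal_pdf_ge0.
  rewrite ger0_norm; last by rewrite divr_ge0 ?(ltW s20)// mulr_ge0 ?normal_pdf_ge0.
  by rewrite ler_pM2r ?invr_gt0// Kg.
- by rewrite lef_pV2.
Qed.

(** The second time derivative is bounded in the same way; [0 <= h] keeps the intermediate times
    above [e]. First order is enough, since [h] will be the square of the step size. *)
Lemma heat_time_taylor : exists2 C : R, 0 <= C &
  forall t y h : R, e <= t -> 0 <= h ->
    `|heat s a (t + h) y - heat s a t y - h * - (z t y * g (z t y) / (2 * t))|
      <= C * h ^+ 2.
Proof.
have [K K0 Kg] := normal_pdf_decay s0.
have s20 : 0 < s ^+ 2 by rewrite exprn_even_gt0.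
have D0 : 0 < 4 * e ^+ 2 by rewrite !mulr_gt0.
pose C : R := (3 * K + K / s ^+ 2) / (4 * e ^+ 2).
have C0 : 0 <= C.
  by rewrite divr_ge0 ?(ltW D0)// addr_ge0 ?mulr_ge0 ?invr_ge0 ?ltW.
exists C => // t y h et h0; have t0 := lt_le_trans e0 et.
have btw (v x : R) : t <= v -> t <= x <= v \/ v <= x <= t -> t <= x.
  by move=> tv [/andP[]//|/andP[vx _]]; exact: le_trans vx.
pose u' t := - (z t y * g (z t y) / (2 * t)).
have lip v : t <= v -> `|u' v - u' t| <= C * `|v - t|.
  move=> tv; apply: (@is_derive_norm_le _ u'
    (fun t => (3 * z t y - z t y ^+ 3 / s ^+ 2) * g (z t y) / (4 * t ^+ 2))).
    by move=> x /(btw _ _ tv) tx; apply: is_derive_heat_time2 => //; exact: lt_le_trans tx.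
  move=> x /(btw _ _ tv) tx; have ex : e <= x by exact: le_trans tx.
  set w := z x y.
  have Dt : 4 * e ^+ 2 <= 4 * x ^+ 2.
    by rewrite ler_pM2l// lerXn2r// nnegrE ltW// (lt_le_trans e0).
  have Dt0 := lt_le_trans D0 Dt.
  rewrite normrM normfV (gtr0_norm Dt0) /C ler_pM//.
  - by rewrite invr_ge0 ltW.
  - rewrite normrM (ger0_norm (normal_pdf_ge0 _ _ _)).
    apply: (@le_trans _ _ ((3 * `|w| + `|w| ^+ 3 / s ^+ 2) * g w)).
      rewrite ler_wpM2r ?normal_pdf_ge0// (le_trans (ler_normB _ _))//.
      by rewrite [X in X + _ <= _]normrM [X in _ + X <= _]normrM normfV normrX (gtr0_norm s20) ger0_norm.
    rewrite mulrDl lerD//.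
      by rewrite -mulrA ler_pM2l// -(expr1 `|w|) Kg.
    by rewrite mulrAC ler_pM2r ?invr_gt0// Kg.
  - by rewrite lef_pV2.
pose f v := heat s a v y - (v - t) * u' t.
have := @is_derive_norm_le _ f (fun v => u' v - u' t) (C * h) t (t + h).
rewrite /f subrr mul0r subr0 [t + h - t]addrAC subrr add0r (ger0_norm h0) -mulrA -expr2.
rewrite [X in `|X| <= _]addrAC; apply.
  move=> v /(btw _ _ (ler_wpDr h0 (lexx t))) tv.
  have ? : is_derive v 1 (fun v => heat s a v y) (u' v).
    by apply: is_derive_heat_time => //; exact: lt_le_trans tv.
  by apply: is_derive_eq; rewrite /GRing.scale/=; ring.
move=> v tv; have tv' := btw _ _ (ler_wpDr h0 (lexx t)) tv.
apply: (le_trans (lip _ tv')); rewrite ler_wpM2l// ger0_norm ?subr_ge0//.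
rewrite lerBlDl; case: tv => [/andP[]//|/andP[_ /le_trans]]; apply.
by rewrite lerDl.
Qed.

End heat_taylor.

(** * Bernoulli steps follow the heat flow *)

(* [bernoulli_step p r psi y] is the expectation of [psi (y + r (b - p))] for a
   Bernoulli variable [b] of parameter [p]. *)
Definition bernoulli_step (R : realType) (p r : R) (psi : R -> R) (y : R) : R :=
  p * psi (y + (1 - p) * r) + (1 - p) * psi (y - p * r).

Section bernoulli_heat.
Variables (R : realType) (p s a e : R).
Hypotheses (p01 : 0 <= p <= 1) (s0 : s != 0) (sp : s ^+ 2 = p * (1 - p)).
Hypothesis e0 : 0 < e.

(** The terms in r cancel because the step is centred. The terms in r^2 add up to half the variance
    p (1 - p) = s^2 times the second space derivative, which is the time derivative. The remainders
    are of order r^3 in space and r^4 <= r^3 in time. *)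
Lemma bernoulli_step_heat : exists2 C : R, 0 <= C &
  forall t y r : R, e <= t -> 0 <= r <= 1 ->
    `|bernoulli_step p r (heat s a t) y - heat s a (t + r ^+ 2) y| <= C * r ^+ 3.
Proof.
have [C1 C10 H1] := heat_space_taylor a s0 e0.
have [C2 C20 H2] := heat_time_taylor a s0 e0.
exists (C1 + C2); first exact: addr_ge0.
move=> t y r et /andP[r0 r1].
have := H1 t y ((1 - p) * r) et; have := H1 t y (- (p * r)) et.
have r20 : 0 <= r ^+ 2 by rewrite sqr_ge0.
have := H2 t y (r ^+ 2) et r20.
set D1 := - (_ / Num.sqrt t); set D2 := - (_ / (2 * t)); set D3 := - (_ / (s ^+ 2 * t)).
(* The heat equation: [D2] is the time derivative and [D3] the second space derivative. *)
have D32 : D3 * (p * (1 - p)) = 2 * D2.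
  rewrite -sp /D3 /D2; field.
  by rewrite s0 sqrtr_eq0 -ltNge (lt_le_trans e0 et)/= gt_eqF// (lt_le_trans e0 et).
rewrite /bernoulli_step; set u := heat s a t y.
set A := heat _ _ _ _ - u - _; set B := heat _ _ _ _ - u - _ - _.
set D := heat _ _ _ _ - u - _ - _ => hA hB hD.
rewrite (_ : _ - _ = (1 - p) * B + p * D - A); last first.
  rewrite /A /B /D; apply/eqP; rewrite -subr_eq0; apply/eqP.
  have -> : D2 = D3 * (p * (1 - p)) / 2 by rewrite D32; field.
  by field.
have /andP[p0 p1] := p01; have p1' : 0 <= 1 - p by rewrite subr_ge0.
have r3 : `|p * r| <= r by rewrite ger0_norm ?mulr_ge0// ler_piMl.
have r3' : `|(1 - p) * r| <= r.
  by rewrite ger0_norm ?mulr_ge0// ler_piMl// lerBlDr lerDl.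
have hB' : `|B| <= C1 * r ^+ 3.
  by apply: (le_trans hB); rewrite ler_wpM2l// normrN lerXn2r// nnegrE.
have hD' : `|D| <= C1 * r ^+ 3.
  by apply: (le_trans hD); rewrite ler_wpM2l// lerXn2r// nnegrE.
have hA' : `|A| <= C2 * r ^+ 3.
  apply: (le_trans hA); rewrite ler_wpM2l// -exprM ler_wiXn2l//.
rewrite (le_trans (ler_normB _ _))// [leRHS]mulrDl lerD//.
rewrite (le_trans (ler_normD _ _))// !normrM (ger0_norm p0) (ger0_norm p1').
have := ler_wpM2l p1' hB'; have := ler_wpM2l p0 hD'.
lra.
Qed.

Lemma bernoulli_step_norm (r K y : R) (f h : R -> R) :
  (forall x, `|f x - h x| <= K) ->
  `|bernoulli_step p r f y - bernoulli_step p r h y| <= K.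
Proof.
move=> fh; rewrite /bernoulli_step.
rewrite (_ : _ - _ = p * (f (y + (1 - p) * r) - h (y + (1 - p) * r)) +
  (1 - p) * (f (y - p * r) - h (y - p * r))); last by ring.
have /andP[p0 p1] := p01; have {}p1 : 0 <= 1 - p by rewrite subr_ge0.
rewrite (le_trans (ler_normD _ _))// !normrM (ger0_norm p0) (ger0_norm p1).
have := ler_wpM2l p0 (fh (y + (1 - p) * r)).
have := ler_wpM2l p1 (fh (y - p * r)).
lra.
Qed.

(** A step is a weighted average, so it does not increase uniform distances and the one-step errors
    add up. All the times are at least [e], so a single [C] serves for every step. *)
Lemma iter_bernoulli_step_heat : exists2 C : R, 0 <= C &
  forall (k : nat) (y r : R), 0 <= r <= 1 ->
    `|iter k (bernoulli_step p r) (heat s a e) y - heat s a (e + k%:R * r ^+ 2) y|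
      <= k%:R * C * r ^+ 3.
Proof.
have [C C0 H] := bernoulli_step_heat; exists C => // k + r r01.
elim: k => [|k IH] y; first by rewrite !mul0r addr0 subrr normr0.
rewrite iterS.
have h1 := bernoulli_step_norm r y IH.
have ek : e <= e + k%:R * r ^+ 2 by rewrite lerDl mulr_ge0 ?sqr_ge0.
have := H _ y r ek r01.
rewrite (_ : e + _ + _ = e + k.+1%:R * r ^+ 2); last by rewrite -natr1; ring.
move=> h2.
have := le_trans (ler_normD _ _) (lerD h1 h2).
rewrite addrA subrK => /le_trans; apply.
by rewrite -natr1 !mulrDl mul1r.
Qed.

End bernoulli_heat.

(** * Szasz operators, and Chernoff's bound for Poisson tails *)

Lemma cvg_series_mull (R : realType) (c l : R) (u : R ^nat) :
  series u @ \oo --> l -> series (fun k => c * u k) @ \oo --> c * l.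
Proof.
move=> ul; rewrite (_ : series _ = fun n => c * series u n).
  by apply: cvgM ul; exact: cvg_cst.
by apply/funext => n; rewrite /series/= mulr_sumr.
Qed.

Section szasz.
Variables (R : realType) (m : nat) (x : R).
Hypothesis x0 : 0 <= x.

Lemma szasz_weight_ge0 k : 0 <= szasz_weight k m x.
Proof. by rewrite !mulr_ge0 ?expR_ge0 ?exprn_ge0 ?mulr_ge0 ?invr_ge0. Qed.

Lemma szasz_weight_cvg1 : series (fun k => szasz_weight k m x) @ \oo --> (1 : R).
Proof.
rewrite -[X in _ --> X](expRxMexpNx_1 (m%:R * x)) mulrC.
by apply: cvg_series_mull; exact: is_cvg_series_exp_coeff.
Qed.

(** Comparison with [M] times the Poisson weights, which sum to 1. This makes the [limn] in
    [szasz_operator] a genuine limit. *)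
Lemma szasz_operator_cvg (G : R -> R) (M : R) : (forall k, `|G (k%:R / m%:R)| <= M) ->
  series (fun k => G (k%:R / m%:R) * szasz_weight k m x) @ \oo -->
    szasz_operator m G x.
Proof.
move=> GM; apply: normed_cvg.
apply: (@series_le_cvg _ _ (fun k => M * szasz_weight k m x)).
- by move=> k /=.
- move=> k; rewrite mulr_ge0 ?szasz_weight_ge0//.
  exact: le_trans (GM 0%N).
- move=> k; rewrite /= normrM (ger0_norm (szasz_weight_ge0 k)).
  by rewrite ler_wpM2r ?szasz_weight_ge0.
- by apply/cvg_ex; exists (M * 1); apply: cvg_series_mull; exact: szasz_weight_cvg1.
Qed.

Lemma szasz_operator1 : szasz_operator m (fun=> 1) x = 1 :> R.
Proof.
apply/cvg_lim => //; rewrite (_ : (fun k => _) = fun k => szasz_weight k m x).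
  exact: szasz_weight_cvg1.
by apply/funext => k; rewrite mul1r.
Qed.

Lemma szasz_operatorB (G H : R -> R) (M N : R) :
  (forall k, `|G (k%:R / m%:R)| <= M) -> (forall k, `|H (k%:R / m%:R)| <= N) ->
  szasz_operator m (fun t => G t - H t) x = szasz_operator m G x - szasz_operator m H x.
Proof.
move=> /szasz_operator_cvg hG /szasz_operator_cvg hH; apply/cvg_lim => //.
rewrite (_ : series _ = fun n => series (fun k => G (k%:R / m%:R) * szasz_weight k m x) n
  - series (fun k => H (k%:R / m%:R) * szasz_weight k m x) n); first exact: cvgB.
apply/funext => n; rewrite /series/= -sumrB; apply: eq_bigr => k _; exact: mulrBl.
Qed.

Lemma szasz_operator_sum (n : nat) (c M : R) (G : nat -> R -> R) :
  (forall i k, `|G i (k%:R / m%:R)| <= M) ->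
  szasz_operator m (fun t => c * \sum_(i < n) G i t) x =
  c * \sum_(i < n) szasz_operator m (G i) x.
Proof.
move=> GM; apply/cvg_lim => //.
rewrite (_ : series _ = fun N => c * \sum_(i < n)
  series (fun k => G i (k%:R / m%:R) * szasz_weight k m x) N).
  apply: cvgM; first exact: cvg_cst.
  apply: cvg_big => [|i _]; first exact: add_continuous.
  exact: szasz_operator_cvg.
apply/funext => N; rewrite /series/= exchange_big/= mulr_sumr; apply: eq_bigr => k _.
by rewrite -mulrA mulr_suml.
Qed.

Lemma szasz_operator_le (G H : R -> R) (M l : R) :
  (forall k, `|G (k%:R / m%:R)| <= M) ->
  series (fun k => H (k%:R / m%:R) * szasz_weight k m x) @ \oo --> l ->
  (forall k, G (k%:R / m%:R) <= H (k%:R / m%:R)) ->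
  szasz_operator m G x <= l.
Proof.
move=> /szasz_operator_cvg GM Hl GH.
apply: (ler_cvg_to GM Hl); apply: nearW => n.
by apply: ler_sum => k _; rewrite ler_wpM2r ?szasz_weight_ge0.
Qed.

(** For a Poisson variable N of mean m x this computes the exponential moment E exp(s (N - m y)). *)
Lemma szasz_expR_cvg (s y : R) : (0 < m)%N ->
  series (fun k => expR (s * (m%:R * (k%:R / m%:R - y))) * szasz_weight k m x)
    @ \oo --> expR (m%:R * (x * (expR s - 1) - s * y)).
Proof.
move=> m0; have m0' : m%:R != 0 :> R by rewrite pnatr_eq0 -lt0n.
pose c := expR (- (s * m%:R * y) - m%:R * x).
rewrite (_ : m%:R * (_ - _) = - (s * m%:R * y) - m%:R * x + m%:R * x * expR s); last by ring.
rewrite (_ : (fun k => _) = fun k => c * exp_coeff (m%:R * x * expR s) k).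
  by rewrite expRD; apply: cvg_series_mull; exact: is_cvg_series_exp_coeff.
apply/funext => k; rewrite /szasz_weight /exp_coeff/=.
rewrite [in RHS]exprMn -expRM_natl mulrA -expRD [RHS]mulrA.
rewrite (_ : s * _ - _ = - (s * m%:R * y) - m%:R * x + k%:R * s); last by field.
by rewrite expRD -/c; ring.
Qed.

(* The left-hand side is Chernoff's bound; it is not optimal for this [s], but
   [1 - s = 2 x / (y + x)] makes [expR s <= (1 - s)^-1] easy to use, and the sign of
   [s] covers both tails at once. *)
Lemma szasz_expR_le (s y : R) : (0 < m)%N -> 0 < x -> 0 <= y ->
  s = (y - x) / (y + x) ->
  expR (m%:R * (x * (expR s - 1) - s * y)) <=
  expR (- (m%:R * ((y - x) ^+ 2 / (2 * (y + x))))).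
Proof.
move=> m0 x_gt0 y0 sE; have yx0 : 0 < y + x by rewrite ltr_wpDl.
rewrite ler_expR -[leRHS]mulrN ler_wpM2l//.
have s1E : 1 - s = 2 * x / (y + x) by rewrite sE; field; rewrite gt_eqF.
have s1 : 0 < 1 - s by rewrite s1E divr_gt0// mulr_gt0.
have es : expR s <= (1 - s)^-1.
  by rewrite -[s in leLHS]opprK expRN lef_pV2 ?posrE ?expR_gt0// expR_ge1Dx.
have := ler_wpM2l x0 es.
rewrite s1E (_ : x * _^-1 = (y + x) / 2); last by field; rewrite !gt_eqF.
rewrite (_ : - ((y - x) ^+ 2 / _) = (y + x) / 2 - x - s * y); first lra.
by rewrite sE; field; rewrite gt_eqF.
Qed.

(** With N Poisson of mean m x, the error is P(N >= m y) if y > x and P(N < m y) if y <= x. The sign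
    of [s] is that of y - x, so in both cases the indicator of the event is at most exp(s (N - m
    y)). *)
Lemma szasz_indic_near (y : R) : (0 < m)%N -> 0 < x -> 0 <= y ->
  `|szasz_operator m (fun t => \1_(`]-oo, t] : set R) y) x -
    \1_(`]-oo, x] : set R) y| <= expR (- (m%:R * ((y - x) ^+ 2 / (2 * (y + x))))).
Proof.
move=> m0 x_gt0 y0; apply: le_trans (szasz_expR_le m0 x_gt0 y0 erefl).
set s := _ / _; have yx0 : 0 < y + x by rewrite ltr_wpDl.
pose I t : R := \1_(`]-oo, t] : set R) y.
have IE t : I t = ((y <= t)%R)%:R by rewrite /I indicE mem_setE in_itv.
have I1 t : `|I t| <= 1 by rewrite IE ger0_norm// lern1 leq_b1.
have := @szasz_expR_cvg s y m0; set e := expR (m%:R * _) => He.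
pose H t := expR (s * (m%:R * (t - y))).
have mdn k : 0 <= s * (m%:R * (k%:R / m%:R - y)) -> 1 <= expR (s * (m%:R * (k%:R / m%:R - y))).
  by move=> h; rewrite -[leLHS]expR0 ler_expR.
rewrite -/(I x) (IE x); have [yx|xy] := leP y x; last first.
  have s_ge0 : 0 <= s by rewrite divr_ge0 ?(ltW yx0)// subr_ge0 ltW.
  rewrite subr0 ger0_norm; last first.
    apply: (cvgr_to_ge (szasz_operator_cvg (fun k => I1 _))).
    by apply: nearW => n; apply: sumr_ge0 => k _; rewrite mulr_ge0 ?szasz_weight_ge0.
  apply: (@szasz_operator_le I H 1 _ (fun k => I1 _) He) => k.
  rewrite IE /H; case: (leP y (_ / _)) => [yk|_]; last by rewrite expR_ge0.
  by apply: mdn; rewrite mulr_ge0// mulr_ge0// subr_ge0.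
have s_le0 : s <= 0 by rewrite pmulr_lle0 ?invr_gt0// subr_le0.
have J1 t : `|1 - I t| <= 1 by rewrite IE; case: (y <= t); rewrite ?subrr ?normr0 ?subr0 ?normr1.
have -> : szasz_operator m I x - 1 = - szasz_operator m (fun t => 1 - I t) x.
  by rewrite (@szasz_operatorB (fun=> 1) I 1 1) ?szasz_operator1 ?opprB// => k; rewrite normr1.
rewrite normrN ger0_norm; last first.
  apply: (cvgr_to_ge (szasz_operator_cvg (fun k => J1 _))).
  apply: nearW => n; apply: sumr_ge0 => k _; rewrite mulr_ge0 ?szasz_weight_ge0// IE.
  by rewrite subr_ge0 lern1 leq_b1.
apply: (@szasz_operator_le (fun t => 1 - I t) H 1 _ (fun k => J1 _) He) => k.
rewrite IE /H; case: (leP y (_ / _)) => [_|yk]; rewrite ?subrr ?expR_ge0// subr0; apply: mdn.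
by rewrite mulr_le0// mulr_ge0_le0// subr_le0 ltW.
Qed.

End szasz.

(** * Bounded measurable functions *)

(** A class stable under the algebraic operations and integrable for every probability, to which the
    integrability conditions below are reduced. *)
Definition bounded_measurable d (T : measurableType d) (R : realType) (f : T -> R) :=
  measurable_fun setT f /\ exists M, forall w, `|f w| <= M.

Section bounded_measurable.
Context d (T : measurableType d) (R : realType).
Implicit Types f h : T -> R.

Lemma bounded_measurable_cst (c : R) : bounded_measurable (fun _ : T => c).
Proof. by split=> //; exists `|c|. Qed.

Lemma bounded_measurableD f h : bounded_measurable f -> bounded_measurable h ->
  bounded_measurable (fun w => f w + h w).
Proof.
move=> [mf [M fM]] [mh [N hN]]; split; first exact: measurable_funD.
by exists (M + N) => w; rewrite (le_trans (ler_normD _ _))// lerD.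
Qed.

Lemma bounded_measurableM f h : bounded_measurable f -> bounded_measurable h ->
  bounded_measurable (fun w => f w * h w).
Proof.
move=> [mf [M fM]] [mh [N hN]]; split; first exact: measurable_funM.
by exists (M * N) => w; rewrite normrM ler_pM.
Qed.

Lemma bounded_measurable_sqr f : bounded_measurable f ->
  bounded_measurable (fun w => f w ^+ 2).
Proof. by move=> bf; under eq_fun do rewrite expr2; exact: bounded_measurableM. Qed.

Lemma bounded_measurableB f h : bounded_measurable f -> bounded_measurable h ->
  bounded_measurable (fun w => f w - h w).
Proof.
move=> mf [mh [N hN]]; apply: bounded_measurableD => //; split.
  exact: measurableT_comp.
by exists N => w; rewrite normrN.
Qed.

Lemma bounded_measurable_sum (I : Type) (s : seq I) (F : I -> T -> R) :
  (forall i, bounded_measurable (F i)) ->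
  bounded_measurable (fun w => \sum_(i <- s) F i w).
Proof.
move=> mF; elim: s => [|i s IH].
  by under eq_fun do rewrite big_nil; exact: bounded_measurable_cst.
by under eq_fun do rewrite big_cons; exact: bounded_measurableD.
Qed.

Lemma bounded_measurable_indic (A : set T) : measurable A ->
  bounded_measurable (\1_A : T -> R).
Proof.
move=> mA; split; first exact: measurable_indic.
by exists 1 => w; rewrite indicE; case: (w \in A); rewrite ?normr1 ?normr0.
Qed.

Lemma bounded_measurable_comp d' (U : measurableType d') (g : U -> T) f :
  measurable_fun setT g -> bounded_measurable f -> bounded_measurable (fun u => f (g u)).
Proof.
move=> mg [mf [M fM]]; split; first exact: measurableT_comp.
by exists M => u.
Qed.

Lemma bounded_measurable_integrable (P : probability T R) (D : set T) f :
  measurable D -> bounded_measurable f -> P.-integrable D (EFin \o f).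
Proof.
move=> mD [mf [M fM]]; apply: measurable_bounded_integrable => //.
- by rewrite (le_lt_trans (probability_le1 _ _))// ltry.
- exact: measurable_funTS.
- exists M; split; first by rewrite num_real.
  by move=> x Mx w _ /=; rewrite (le_trans (fM w))// ltW.
Qed.

End bounded_measurable.

(** * Expectations of functions of one or two observations *)

Section iid.
Context d (T : measurableType d) (R : realType) (P : probability T R).
Variables (X : nat -> {RV P >-> R}).
Implicit Types h : R -> R.

Lemma bounded_measurable_RV h i : bounded_measurable h ->
  bounded_measurable (fun w => h (X i w)).
Proof. exact: bounded_measurable_comp. Qed.

Lemma Rintegral_distribution h i : bounded_measurable h ->
  \int[distribution P (X i)]_y h y = \int[P]_w h (X i w).
Proof.
move=> bh; congr fine; rewrite /distribution integral_pushforward//.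
  by apply/measurable_EFinP; case: bh.
apply: (@bounded_measurable_integrable _ _ _ P _ (h \o X i)).
  by rewrite preimage_setT.
exact: bounded_measurable_RV.
Qed.

Lemma Rintegral_ident h i j : identically_distributed X -> bounded_measurable h ->
  \int[P]_w h (X i w) = \int[P]_w h (X j w).
Proof.
move=> Xid bh; rewrite -!Rintegral_distribution//; congr fine.
by apply: eq_measure_integral => A mA _; exact: Xid.
Qed.

(** Independence says that the law of the pair and the product of the two laws agree on rectangles,
    hence everywhere; Fubini's theorem then separates the factors. *)
Lemma Rintegral_indepM h1 h2 i j : mutually_independent X -> i != j ->
  bounded_measurable h1 -> bounded_measurable h2 ->
  \int[P]_w (h1 (X i w) * h2 (X j w)) =
  (\int[P]_w h1 (X i w)) * \int[P]_w h2 (X j w).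
Proof.
move=> Xind ij bh1 bh2.
pose phi w := (X i w, X j w).
have mphi : measurable_fun setT phi by exact: measurable_fun_pair.
pose f (z : R * R) := h1 z.1 * h2 z.2.
have bf : bounded_measurable f.
  by apply: bounded_measurableM; apply: bounded_measurable_comp.
pose m1 := distribution P (X i); pose m2 := distribution P (X j).
transitivity (\int[(m1 \x m2)%E]_z f z).
  congr fine; transitivity (\int[pushforward P phi]_z (f z)%:E)%E.
    rewrite integral_pushforward//; first by apply/measurable_EFinP; case: bf.
      apply: (@bounded_measurable_integrable _ _ _ P _ (f \o phi)).
    by rewrite preimage_setT.
  exact: bounded_measurable_comp bf.
  apply: eq_measure_integral => A mA _; apply/esym.
  apply: product_measure_unique => // B C mB mC.
  rewrite /pushforward/=.
  have := Xind [fset i; j]%fset (fun k => if k == i then B else C).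
  rewrite big_fsetU1 ?inE//= big_seq_fset1 eqxx eq_sym (negbTE ij) => <-.
    congr (P _); apply/seteqP; split=> w /=.
      move=> [Bw Cw] k /=; rewrite !inE => /orP[/eqP ->|/eqP ->]; first by rewrite eqxx.
      by rewrite eq_sym (negbTE ij).
    move=> H; split; first by have := H i; rewrite /= !inE eqxx; exact.
    by have := H j; rewrite /= !inE eqxx orbT eq_sym (negbTE ij); exact.
  by move=> k; case: ifP.
have bX h k : bounded_measurable h ->
    (distribution P (X k)).-integrable setT (EFin \o h).
  by move=> bh; exact: bounded_measurable_integrable.
rewrite -!Rintegral_distribution// -/m1 -/m2.
rewrite {1}/Rintegral -integral12_prod_meas1/=; last first.
  exact: (@bounded_measurable_integrable _ _ _ _ _ f).
rewrite (_ : (fun x => _) = fun x => (h1 x * \int[m2]_y h2 y)%:E); last first.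
  apply/funext => x; rewrite /f/= -RintegralZl ?bX// fineK//.
  apply: integrable_fin_num => //.
  apply: (@bounded_measurable_integrable _ _ _ m2 _ (fun y => h1 x * h2 y)) => //.
  by apply: bounded_measurableM => //; exact: bounded_measurable_cst.
by rewrite -[LHS]/(\int[m1]_x (h1 x * _)) RintegralZr// bX.
Qed.

End iid.

(** * Sums of i.i.d. terms: second moments and Bernoulli walks *)

Section iid_sums.
Context d (T : measurableType d) (R : realType) (P : probability T R).
Variables (X : nat -> {RV P >-> R}).
Hypotheses (X_indep : mutually_independent X) (X_idist : identically_distributed X).

Lemma Rintegral_sum_bounded (I : Type) (s : seq I) (F : I -> T -> R) :
  (forall i, bounded_measurable (F i)) ->
  \int[P]_w (\sum_(i <- s) F i w) = \sum_(i <- s) \int[P]_w F i w.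
Proof.
move=> bF; elim: s => [|i s IH].
  by rewrite big_nil; under eq_Rintegral do rewrite big_nil; rewrite Rintegral_cst ?mul0r.
rewrite big_cons -IH -RintegralD//.
- by apply: eq_Rintegral => w _; rewrite big_cons.
- exact: bounded_measurable_integrable.
- apply: bounded_measurable_integrable => //.
  exact: bounded_measurable_sum.
Qed.

(** The cross terms vanish by independence and centring. *)
Lemma Rintegral_sqr_sum (h : R -> R) n : bounded_measurable h ->
  \int[P]_w h (X 0%N w) = 0 ->
  \int[P]_w (\sum_(i < n) h (X i w)) ^+ 2 = n%:R * \int[P]_w h (X 0%N w) ^+ 2.
Proof.
move=> bh h0; have bhX i : bounded_measurable (fun w => h (X i w)).
  exact: (@bounded_measurable_RV _ _ _ P X).
have bS k : bounded_measurable (fun w => \sum_(i < k) h (X i w)).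
  by apply: bounded_measurable_sum => i; exact: bhX.
have int (f : T -> R) : bounded_measurable f -> P.-integrable setT (EFin \o f).
  by move=> ?; exact: bounded_measurable_integrable.
elim: n => [|n IH].
  rewrite mul0r; under eq_Rintegral do rewrite big_ord0 expr0n/=.
  by rewrite Rintegral_cst ?mul0r.
have hSh : \int[P]_w (\sum_(i < n) (h (X i w) * h (X n w))) = 0.
  rewrite Rintegral_sum_bounded; last by move=> i; exact: bounded_measurableM.
  rewrite big1// => i _; rewrite (@Rintegral_indepM _ _ _ P X h h i n)//.
    by rewrite (@Rintegral_ident _ _ _ P X h n 0)// h0 mulr0.
  by rewrite neq_ltn ltn_ord.
transitivity (\int[P]_w ((\sum_(i < n) h (X i w)) ^+ 2
    + (2 * (\sum_(i < n) (h (X i w) * h (X n w))) + h (X n w) ^+ 2))).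
  by apply: eq_Rintegral => w _; rewrite big_ord_recr/= -mulr_suml; ring.
have b1 : bounded_measurable (fun w => (\sum_(i < n) h (X i w)) ^+ 2).
  exact: bounded_measurable_sqr.
have b2 : bounded_measurable (fun w => \sum_(i < n) (h (X i w) * h (X n w))).
  by apply: bounded_measurable_sum => i; exact: bounded_measurableM.
have b2' : bounded_measurable (fun w => 2 * \sum_(i < n) (h (X i w) * h (X n w))).
  by apply: bounded_measurableM => //; exact: bounded_measurable_cst.
have b3 : bounded_measurable (fun w => h (X n w) ^+ 2).
  exact: bounded_measurable_sqr.
rewrite RintegralD//; [|exact: int|by apply: int; exact: bounded_measurableD].
rewrite IH RintegralD//; [|exact: int|exact: int].
rewrite RintegralZl//; last exact: int.
rewrite hSh mulr0 add0r -natr1 mulrDl mul1r; congr (_ + _).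
by apply: (@Rintegral_ident _ _ _ _ _ (fun y => h y ^+ 2)) => //; exact: bounded_measurable_sqr.
Qed.

(* The event [E], which does not involve the first [k] variables, makes the
   induction on [k] go through: conditioning on [X k \in B] only changes [E], so
   that independence is used for events only. *)
Lemma Rintegral_bernoulli_walk (B : set R) (p r : R) (psi : R -> R) :
  measurable B -> (forall i, P (X i @^-1` B) = p%:E) -> bounded_measurable psi ->
  forall (k : nat) (J : {fset nat}) (A : nat -> set R) (y : R),
    (forall i, measurable (A i)) ->
    (forall i, (i < k)%N -> i \in J /\ A i = setT) ->
    let E := \bigcap_(i in [set` J]) (X i @^-1` A i) in
    \int[P]_(w in E) psi (y + \sum_(i < k) (\1_B (X i w) - p) * r) =
    fine (P E) * iter k (bernoulli_step p r) psi y.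
Proof.
move=> mB PB bpsi; elim=> [|k IH] J A y mA AT E.
  under eq_Rintegral do rewrite big_ord0 addr0.
  by rewrite Rintegral_cst 1?mulrC//; apply: fin_bigcap_measurable => // i _; exact: measurable_funPTI.
have mE A' : (forall i, measurable (A' i)) ->
    measurable (\bigcap_(i in [set` J]) (X i @^-1` A' i)).
  by move=> mA'; apply: fin_bigcap_measurable => // i _; exact: measurable_funPTI.
have [kJ AkT] := AT k (ltnSn k).
(* Since [A k] is the whole line, replacing it by [C] intersects [E] with the event that [X k] lies
   in [C]. *)
pose A' C i := if i == k then C else A i.
pose E' C := \bigcap_(i in [set` J]) (X i @^-1` A' C i).
have E'E C : E' C = E `&` X k @^-1` C.
  apply/seteqP; split=> w.
    move=> Ew; split; last by have := Ew k kJ; rewrite /A' /= eqxx.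
    move=> i iJ; have := Ew i iJ; rewrite /A' /=; case: eqP => // ->.
    by rewrite AkT.
  by move=> [Ew Cw] i iJ; rewrite /A' /=; case: eqP => [->//|_]; exact: Ew.
have step C q c : measurable C -> P (X k @^-1` C) = q%:E ->
    (forall w, C (X k w) -> \1_B (X k w) - p = c) ->
    \int[P]_(w in E' C) psi (y + \sum_(i < k.+1) (\1_B (X i w) - p) * r) =
    fine (P E) * q * iter k (bernoulli_step p r) psi (y + c * r).
  move=> mC PC Cc; have mA' i : measurable (A' C i) by rewrite /A'; case: ifP.
  (* On [E' C] the last increment is the constant [c * r]; it moves into the starting point, over
     which the induction hypothesis is quantified. *)
  transitivity (\int[P]_(w in E' C) psi (y + c * r + \sum_(i < k) (\1_B (X i w) - p) * r)).
    apply: eq_Rintegral => w; rewrite inE E'E => -[_ Cw].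
    by rewrite big_ord_recr/= Cc// [in RHS]addrAC addrA.
  rewrite IH//; last first.
    move=> i ik; have [|iJ Ai] := AT i; first by rewrite ltnS ltnW.
    by split=> //; rewrite /A' ltn_eqF.
  congr (_ * _); rewrite -/(E' C).
  (* Taking [setT] for [C'] identifies the product over the other indices with [P E]; hence
     [P (E' C)] is [P E] times [q]. *)
  have indep C' : measurable C' -> P (E' C') = (P (X k @^-1` C') *
      \prod_(i <- (J `\ k)%fset) P (X i @^-1` A i))%E.
    move=> mC'; rewrite X_indep; last by move=> i; rewrite /A'; case: ifP.
    rewrite (big_fsetD1 k)//= /A' eqxx; congr (_ * _)%E.
    rewrite !big_seq; apply: eq_bigr => i; rewrite !inE => /andP[/negbTE -> _].
    by [].
  rewrite indep// PC.
  have := indep setT measurableT; rewrite E'E preimage_setT setIT probability_setT mul1e => <-.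
  have finE : P E \is a fin_num by apply: fin_num_measure; exact: mE.
  by rewrite fineM//= [LHS]mulrC.
(* Splitting on the outcome of [X k] produces the two terms of [bernoulli_step]. *)
have EU : E = E' B `|` E' (~` B).
  by rewrite !E'E -setIUr -preimage_setU setUv preimage_setT setIT.
rewrite {1}EU Rintegral_setU//; first last.
- rewrite disj_set2E !E'E; apply/eqP; rewrite -subset0 => w [[_ Bw] [_]].
  by rewrite /= => /(_ Bw).
- rewrite -EU; apply: (@bounded_measurable_integrable _ _ _ P _
    (fun w => psi (y + \sum_(i < k.+1) (\1_B (X i w) - p) * r))); first exact: mE.
  apply: bounded_measurable_comp => //.
  apply: measurable_funD => //; apply: measurable_sum => i.
  apply: measurable_funM => //; apply: measurable_funB => //.
  by apply: measurableT_comp.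
- by rewrite E'E; apply: measurableI; [exact: mE|apply: measurable_funPTI; exact: measurableC].
- by rewrite E'E; apply: measurableI; [exact: mE|exact: measurable_funPTI].
rewrite (@step B p (1 - p)) ?(@step (~` B) (1 - p) (- p)) ?PB//.
- by rewrite iterS /bernoulli_step mulNr; ring.
- exact: measurableC.
- by rewrite preimage_setC probability_setC ?PB//; exact: measurable_funPTI.
- by move=> w Bw; rewrite indicE memNset// sub0r.
- by move=> w Bw; rewrite indicE mem_set.
Qed.

End iid_sums.

(** * The Poisson tail as a function of an observation *)

Lemma cvg_of_shiftS (R : realType) (u : R ^nat) (l : R) :
  u n.+1 @[n --> \oo] --> l -> u @ \oo --> l.
Proof. by rewrite -(cvg_shiftS u). Qed.

(* The probability that a Poisson variable of mean [m x] is at least [m y]. *)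
Definition szasz_indic (R : realType) (m : nat) (x y : R) : R :=
  szasz_operator m (fun t => \1_(`]-oo, t] : set R) y) x.

Lemma szasz_estimatorE (T : Type) (R : realType) (X : nat -> T -> R) (m n : nat) (x : R) w :
  0 <= x ->
  szasz_estimator X m n x w = n%:R^-1 * \sum_(i < n) szasz_indic m x (X i w).
Proof.
move=> x0; rewrite /szasz_estimator /empirical_cdf.
rewrite (szasz_operator_sum x0 n (n%:R^-1) (M := 1)
  (G := fun i t => \1_(`]-oo, t] : set R) (X i w)))// => i k.
by rewrite indicE; case: (_ \in _); rewrite ?normr1 ?normr0.
Qed.

Section szasz_indic.
Variables (R : realType) (m : nat) (x : R).
Hypothesis x0 : 0 <= x.

Let indic1 t y : `|\1_(`]-oo, t] : set R) y| <= 1 :> R.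
Proof. by rewrite indicE; case: (_ \in _); rewrite ?normr1 ?normr0. Qed.

(** Finite combinations of indicators, with values in [0, 1], that converge to [szasz_indic]. They
    give its measurability, and its mean by dominated convergence. *)
Let partial N y := series (fun k => \1_(`]-oo, k%:R / m%:R] : set R) y * szasz_weight k m x) N.

Let partial_cvg y : partial ^~ y @ \oo --> szasz_indic m x y.
Proof. exact: (szasz_operator_cvg x0 (fun k => indic1 _ y)). Qed.

Let partial_bm N : bounded_measurable (partial N).
Proof.
rewrite /partial /series/=; apply: bounded_measurable_sum => k.
apply: bounded_measurableM; last exact: bounded_measurable_cst.
exact: bounded_measurable_indic.
Qed.

Let partial_norm N y : `|partial N y| <= 1.
Proof.
rewrite ger0_norm; last first.
  by apply: sumr_ge0 => k _; rewrite mulr_ge0 ?szasz_weight_ge0// indicE.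
apply: (@le_trans _ _ (series (fun k => szasz_weight k m x) N)).
  by apply: ler_sum => k _; rewrite ler_piMl ?szasz_weight_ge0.
rewrite -(cvg_lim _ (szasz_weight_cvg1 m x))//.
apply: nondecreasing_cvgn_le; last by apply/cvg_ex; exists 1; exact: szasz_weight_cvg1.
by apply: nondecreasing_series => k _ _; exact: szasz_weight_ge0.
Qed.

Lemma bounded_measurable_szasz_indic : bounded_measurable (szasz_indic m x).
Proof.
split.
  apply: (measurable_fun_cvg (h := partial)) => [N|y _]; last exact: partial_cvg.
  by have [] := partial_bm N.
exists 1 => y; apply: (cvgr_to_le (cvg_norm (partial_cvg (y := y)))).
by apply: nearW => N; exact: partial_norm.
Qed.

(** The indicator in the k-th term of a partial sum has mean F(k/m); dominated convergence passes to
    the whole series. *)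
Lemma Rintegral_szasz_indic d (T : measurableType d) (P : probability T R)
    (X : {RV P >-> R}) (F : R -> R) : (forall y, cdf X y = (F y)%:E) ->
  \int[P]_w szasz_indic m x (X w) = szasz_operator m F x.
Proof.
move=> F_cdf.
have bX (h : R -> R) : bounded_measurable h -> bounded_measurable (fun w => h (X w)).
  by move=> bh; exact: bounded_measurable_comp.
have F1 y : `|F y| <= 1.
  have : (0 <= (F y)%:E <= 1)%E by rewrite -F_cdf cdf_ge0 cdf_le1.
  by rewrite !lee_fin => /andP[? ?]; rewrite ger0_norm.
have bI k : bounded_measurable (fun w => \1_(`]-oo, k%:R / m%:R] : set R) (X w) : R).
  by apply: (bX \1_(`]-oo, k%:R / m%:R] : set R)); exact: bounded_measurable_indic.
have intN N : \int[P]_w partial N (X w) =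
    series (fun k => F (k%:R / m%:R) * szasz_weight k m x) N.
  rewrite /partial /series/= Rintegral_sum_bounded; last first.
    by move=> k; exact: (bounded_measurableM (bI k) (bounded_measurable_cst _ _)).
  apply: eq_bigr => k _; rewrite RintegralZr//; last first.
    exact: (bounded_measurable_integrable _ _ (bI k)).
  congr (_ * _); rewrite /Rintegral.
  have -> : (F (k%:R / m%:R)) = fine (cdf X (k%:R / m%:R)) by rewrite F_cdf.
  congr fine; rewrite /cdf /distribution /pushforward.
  rewrite -[X in _ = P X]setIT -integral_indic//; last exact: measurable_funPTI.
have [] := @dominated_convergence _ _ _ P setT measurableT
  (fun N w => (partial N (X w))%:E) (fun w => (szasz_indic m x (X w))%:E) (cst 1%E).
- move=> N; apply/measurable_EFinP; by have [] := bX _ (partial_bm N).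
- by apply/measurable_EFinP; have [] := bX _ bounded_measurable_szasz_indic.
- apply: aeW => w _; apply/cvg_EFin; first exact: nearW.
  exact: partial_cvg.
- by apply: (@bounded_measurable_integrable _ _ _ P _ (fun=> 1)) => //; exact: bounded_measurable_cst.
- by apply: aeW => w N _; rewrite lee_fin partial_norm.
move=> intf _; rewrite -[X in _ --> X -> _]fineK; last exact: integrable_fin_num.
move=> /fine_cvgP[_ cvgI].
apply/esym/cvg_lim => //; apply: cvg_trans cvgI; rewrite -(eq_cvg _ _ intN).
exact: cvg_refl.
Qed.

End szasz_indic.

(** * Mean square convergence of the Poisson tail to the indicator *)

Section szasz_indic_L2.
Context d (T : measurableType d) (R : realType) (P : probability T R).
Variables (X : {RV P >-> R}) (F : R -> R) (x : R) (m : nat -> nat).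
Hypotheses (X_ge0 : forall w, 0 <= X w) (F_cdf : forall y, cdf X y = (F y)%:E).
Hypotheses (F_cont : {for x, continuous F}) (x_gt0 : 0 < x).
Hypotheses (m_gt0 : forall n, (0 < n)%N -> (0 < m n)%N).
Hypothesis (m_oo : m n @[n --> \oo] --> \oo).

(** P(X = x) is at most F(x) - F(x - e) for every e > 0, and this tends to 0 by continuity. *)
Lemma cdf_continuous_atom : P (X @^-1` [set x]) = 0%E.
Proof.
have mX A : measurable A -> measurable (X @^-1` A) by move=> mA; exact: measurable_funPTI.
have finP A : measurable A -> P (X @^-1` A) \is a fin_num.
  by move=> mA; apply: fin_num_measure; exact: mX.
rewrite -[LHS]fineK ?finP//; congr EFin; apply/eqP; rewrite eq_le fine_ge0// andbT.
suff H : F x - F (x - e) @[e --> 0^'+] --> F x - F (x - 0).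
  move: H; rewrite subr0 subrr => H; apply: (cvgr_to_ge H).
  near=> e; rewrite lerBrDl -lee_fin EFinD -F_cdf fineK ?finP// -F_cdf.
  rewrite /cdf /distribution /pushforward.
  rewrite -measureU//; [|exact: mX|].
    apply: le_measure; rewrite ?inE; [|exact: mX|].
      by apply: measurableU; exact: mX.
    move=> w []; rewrite /= !in_itv/=; last by move=> ->.
    by move=> /le_trans; apply; rewrite gerBl.
  apply/seteqP; split=> w //=; rewrite in_itv/= => -[Xw Xx].
  by move: Xw; rewrite Xx leNgt gtrBl => /negP; apply.
apply: cvgB; first exact: cvg_cst.
apply: continuous_cvg; first by rewrite subr0.
apply: cvgB; first exact: cvg_cst.
exact: cvg_at_right_filter.
Unshelve. all: by end_near. Qed.

(** Chernoff's bound is [q ^+ m n] with a fixed [q < 1], so it tends to 0 however slowly [m n]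
    grows. *)
Lemma szasz_indic_cvg (y : R) : 0 <= y -> y != x ->
  szasz_indic (m n) x y - \1_(`]-oo, x] : set R) y @[n --> \oo] --> 0.
Proof.
move=> y0 yx; have yx0 : 0 < y + x by rewrite ltr_wpDl.
pose q := expR (- ((y - x) ^+ 2 / (2 * (y + x)))).
have q1 : `|q| < 1.
  rewrite ger0_norm ?expR_ge0// expR_lt1 oppr_lt0 divr_gt0//; last by rewrite mulr_gt0.
  by rewrite exprn_even_gt0// subr_eq0.
apply/norm_cvg0P; apply: (@squeeze_cvgr _ _ _ _ (cst 0) (fun n => q ^+ (m n))).
- near=> n; rewrite normr_ge0/= -expRM_natl mulrN.
  by apply: szasz_indic_near => //; [exact: ltW|apply: m_gt0; near: n; exact: nbhs_infty_gt].
- exact: cvg_cst.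
- exact: (cvg_comp _ _ m_oo (cvg_expr q1)).
Unshelve. all: by end_near. Qed.

(** Dominated convergence: the integrands are bounded by 1 and converge off the null event X = x. *)
Lemma szasz_indic_L2 :
  \int[P]_w (szasz_indic (m n) x (X w) - \1_(`]-oo, x] : set R) (X w)) ^+ 2 @[n --> \oo]
    --> (0 : R).
Proof.
pose h n y := szasz_indic (m n) x y - \1_(`]-oo, x] : set R) y.
have bh n : bounded_measurable (fun w => h n (X w) ^+ 2).
  apply: bounded_measurable_sqr; apply: (@bounded_measurable_comp _ _ _ _ _ X (h n)) => //.
  apply: bounded_measurableB; last exact: bounded_measurable_indic.
  by apply: bounded_measurable_szasz_indic; exact: ltW.
have h1 n y : (0 < n)%N -> 0 <= y -> `|h n y| <= 1.
  move=> n0 y0; apply: (le_trans (szasz_indic_near (ltW x_gt0) (m_gt0 n0) x_gt0 y0)).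
  rewrite -[leRHS]expR0 ler_expR oppr_le0 mulr_ge0// divr_ge0 ?sqr_ge0//.
  by rewrite mulr_ge0// addr_ge0// ltW.
(* The index is shifted by one because [m 0] may be 0, where [szasz_indic_near] does not apply. *)
have [] := @dominated_convergence _ _ _ P setT measurableT
  (fun n w => (h n.+1 (X w) ^+ 2)%:E) (cst 0%E) (cst 1%E).
- by move=> n; apply/measurable_EFinP; have [] := bh n.+1.
- by [].
- exists (X @^-1` [set x]); split.
  + exact: measurable_funPTI.
  + exact: cdf_continuous_atom.
  move=> w /= /not_implyP[_ ncvg]; apply/eqP/negPn/negP => Xx; apply: ncvg.
  apply/cvg_EFin; first exact: nearW.
  rewrite -[X in _ --> X](mulr0 0).
  have := szasz_indic_cvg (X_ge0 w) Xx; rewrite -(cvg_shiftS (fun n => h n (X w))) => hX.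
  exact: cvgM.
- by apply: (@bounded_measurable_integrable _ _ _ P _ (fun=> 1)) => //; exact: bounded_measurable_cst.
- apply: aeW => w n _; rewrite lee_fin normrX; apply: exprn_ile1 => //.
  exact: h1.
move=> _ _; rewrite integral0 => /fine_cvgP[_ H].
exact: (cvg_of_shiftS (u := fun n => \int[P]_w h n (X w) ^+ 2)) H.
Qed.

End szasz_indic_L2.

(** * The normalised estimator and the Bernoulli walk that approximates it *)

Lemma bounded_measurable_heat (R : realType) (s a e : R) : s != 0 ->
  bounded_measurable (heat s a e).
Proof.
move=> s0; split.
  apply: continuous_measurable_fun => y.
  have ? := is_derive_heat_space a s0 e y.
  exact/differentiable_continuous/derivable1_diffP.
by exists 1 => y; rewrite ger0_norm ?normal_cdf_le1 ?normal_cdf_ge0.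
Qed.

Section szasz_clt.
Context d (T : measurableType d) (R : realType) (P : probability T R).
Variables (X : nat -> {RV P >-> R}) (F : R -> R) (x : R) (m : nat -> nat).
Hypotheses (X_indep : mutually_independent X) (X_idist : identically_distributed X).
Hypotheses (X_ge0 : forall i w, 0 <= X i w) (F_cdf : forall y, cdf (X 0%N) y = (F y)%:E).
Hypotheses (F_cont : {for x, continuous F}) (x_gt0 : 0 < x).
Hypotheses (m_gt0 : forall n, (0 < n)%N -> (0 < m n)%N).
Hypothesis (m_oo : m n @[n --> \oo] --> \oo).
Hypotheses (Fx_gt0 : 0 < F x) (Fx_lt1 : F x < 1).

Local Notation s := (Num.sqrt (F x * (1 - F x))).
Local Notation B := (`]-oo, x]%classic : set R).

Let x_ge0 : 0 <= x. Proof. exact: ltW. Qed.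

Let s2 : s ^+ 2 = F x * (1 - F x).
Proof. by rewrite sqr_sqrtr// mulr_ge0 ?subr_ge0 ?ltW. Qed.

Let s0 : s != 0.
Proof. by rewrite gt_eqF// sqrtr_gt0 mulr_gt0// subr_gt0. Qed.

Let PB i : P (X i @^-1` B) = (F x)%:E.
Proof.
rewrite -F_cdf /cdf; have mB : measurable B by [].
exact: (X_idist i 0 mB).
Qed.

(** This is n^(1/2) (F_n(x) - F(x)), written as a sum of n centred Bernoulli steps of size n^(-1/2)
    to suit [Rintegral_bernoulli_walk]. *)
Definition bernoulli_walk n w := \sum_(i < n) (\1_B (X i w) - F x) * (Num.sqrt n%:R)^-1.

Definition szasz_walk n w :=
  Num.sqrt n%:R * (szasz_estimator X (m n) n x w - szasz_operator (m n) F x).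

Lemma bounded_measurable_bernoulli_walk n : bounded_measurable (bernoulli_walk n).
Proof.
apply: bounded_measurable_sum => i; apply: bounded_measurableM.
  apply: bounded_measurableB; last exact: bounded_measurable_cst.
  apply: (@bounded_measurable_RV _ _ _ P X (\1_B : R -> R)).
  exact: bounded_measurable_indic.
exact: bounded_measurable_cst.
Qed.

Lemma bounded_measurable_szasz_estimator n :
  bounded_measurable (szasz_estimator X (m n) n x).
Proof.
rewrite (_ : szasz_estimator _ _ _ _ =
  fun w => n%:R^-1 * \sum_(i < n) szasz_indic (m n) x (X i w)).
  apply: bounded_measurableM; first exact: bounded_measurable_cst.
  apply: bounded_measurable_sum => i.
  apply: (@bounded_measurable_RV _ _ _ P X (szasz_indic (m n) x)).
  exact: bounded_measurable_szasz_indic.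
by apply/funext => w; exact: szasz_estimatorE.
Qed.

Lemma bounded_measurable_szasz_walk n : bounded_measurable (szasz_walk n).
Proof.
apply: bounded_measurableM; first exact: bounded_measurable_cst.
apply: bounded_measurableB; last exact: bounded_measurable_cst.
exact: bounded_measurable_szasz_estimator.
Qed.

Lemma Rintegral_szasz_estimator n : (0 < n)%N ->
  \int[P]_w szasz_estimator X (m n) n x w = szasz_operator (m n) F x.
Proof.
move=> n0; have bk : bounded_measurable (szasz_indic (m n) x).
  exact: bounded_measurable_szasz_indic.
have bkX i : bounded_measurable (fun w => szasz_indic (m n) x (X i w)).
  exact: (@bounded_measurable_RV _ _ _ P X).
under eq_Rintegral do rewrite szasz_estimatorE//.
rewrite RintegralZl//; last first.
  apply: (@bounded_measurable_integrable _ _ _ P _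
    (fun w => \sum_(i < n) szasz_indic (m n) x (X i w))) => //.
  by apply: bounded_measurable_sum => i; exact: bkX.
rewrite (Rintegral_sum_bounded P _ (fun i : 'I_n => bkX i)).
rewrite (eq_bigr (fun=> szasz_operator (m n) F x)) => [|i _].
  by rewrite sumr_const card_ord -[X in _ * X]mulr_natl mulrA mulVf ?mul1r// pnatr_eq0 -lt0n.
rewrite -(Rintegral_szasz_indic (m n) x_ge0 F_cdf).
exact: (@Rintegral_ident _ _ _ P X (szasz_indic (m n) x) i 0).
Qed.

Lemma sqrt_nat_inv_cvg0 : (Num.sqrt n%:R)^-1 @[n --> \oo] --> (0 : R).
Proof.
apply/cvgrPdist_lt => e e0; near=> n.
have n0 : 0 < n%:R :> R by rewrite ltr0n; near: n; exact: nbhs_infty_gt.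
rewrite sub0r normrN ger0_norm ?invr_ge0//.
rewrite -[e]invrK ltf_pV2 ?posrE ?invr_gt0 ?sqrtr_gt0//.
rewrite -[ltLHS]ger0_norm ?invr_ge0 ?(ltW e0)// -sqrtr_sqr ltr_sqrt//.
near: n; exact: nbhs_infty_gtr.
Unshelve. all: by end_near. Qed.

(** With r = n^(-1/2), n steps take the time n r^2 = 1, and the accumulated error n C r^3 = C r
    vanishes. *)
Lemma bernoulli_walk_heat (a e : R) : 0 < e ->
  \int[P]_w heat s a e (bernoulli_walk n w) @[n --> \oo] --> heat s a (e + 1) 0.
Proof.
move=> e0; have p01 : 0 <= F x <= 1 by rewrite !ltW.
have [C C0 HC] := iter_bernoulli_step_heat a p01 s0 s2 e0.
have bpsi := bounded_measurable_heat a e s0.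
have intE n : \int[P]_w heat s a e (bernoulli_walk n w) =
    iter n (bernoulli_step (F x) (Num.sqrt n%:R)^-1) (heat s a e) 0.
  have mB : measurable B by [].
  (* With every set equal to [setT] the conditioning event is the whole space; the index set only
     has to contain the indices below [n]. *)
  have /= := @Rintegral_bernoulli_walk _ _ _ P X X_indep B (F x) (Num.sqrt n%:R)^-1
    (heat s a e) mB PB bpsi n [fset i | i in iota 0 n]%fset (fun=> setT) 0
    (fun=> measurableT).
  rewrite (_ : \bigcap_(i in _) _ = setT); last by apply/seteqP; split.
  rewrite probability_setT/= mul1r => <-.
    by apply: eq_Rintegral => w _; rewrite add0r.
  by move=> i ni; split=> //; rewrite in_fset/= mem_iota.
under eq_cvg do rewrite intE.
have H0 : C * (Num.sqrt n%:R)^-1 @[n --> \oo] --> (0 : R).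
  by rewrite -[X in _ --> X](mulr0 C); apply: cvgM; [exact: cvg_cst|exact: sqrt_nat_inv_cvg0].
apply/cvgrPdist_le => eps eps0; near=> n.
have n0 : 0 < n%:R :> R by rewrite ltr0n; near: n; exact: nbhs_infty_gt.
have q0 : 0 < Num.sqrt n%:R :> R by rewrite sqrtr_gt0.
have qi0 : 0 <= (Num.sqrt n%:R)^-1 :> R by rewrite invr_ge0 ltW.
have qi1 : (Num.sqrt n%:R)^-1 <= 1 :> R.
  by rewrite invf_le1// -[leLHS]sqrtr1 ler_wsqrtr// ler1n -(ltr0n R).
have r01 : (0 : R) <= (Num.sqrt n%:R)^-1 <= (1 : R) by rewrite qi0 qi1.
have nr : n%:R * (Num.sqrt n%:R)^-1 ^+ 2 = 1 :> R.
  by rewrite exprVn sqr_sqrtr ?ltW// divff// gt_eqF.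
have := HC n 0 _ r01; rewrite nr distrC => /le_trans; apply.
rewrite (_ : _ * _ = C * (Num.sqrt n%:R)^-1); last first.
  move: nr; set q := (Num.sqrt n%:R)^-1; set N := n%:R => Nq.
  by rewrite -[RHS]mulr1 -[X in _ = _ * X]Nq; ring.
near: n; move/cvgrPdist_le : H0 => /(_ _ eps0); apply: filterS => n.
by rewrite sub0r normrN => /(le_trans (ler_norm _)).
Unshelve. all: by end_near. Qed.

(** The difference is n^(-1/2) times a sum of n i.i.d. terms [h n (X i w) - c n], centred because
    [c n] is the mean of [h n]. Its second moment is thus the variance of a single term, whatever n
    > 0. *)
Lemma szasz_walk_L2 :
  \int[P]_w (szasz_walk n w - bernoulli_walk n w) ^+ 2 @[n --> \oo] --> (0 : R).
Proof.
pose h n y := szasz_indic (m n) x y - \1_B y.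
pose c n := szasz_operator (m n) F x - F x.
have bh n : bounded_measurable (h n).
  apply: bounded_measurableB; last exact: bounded_measurable_indic.
  exact: bounded_measurable_szasz_indic.
have bhX n i : bounded_measurable (fun w => h n (X i w)).
  exact: (@bounded_measurable_RV _ _ _ P X).
have int (f : T -> R) : bounded_measurable f -> P.-integrable setT (EFin \o f).
  by move=> ?; exact: bounded_measurable_integrable.
have fP1 : fine (P setT) = 1 by rewrite probability_setT.
have hc n : \int[P]_w h n (X 0%N w) = c n.
  rewrite RintegralB//; last 2 first.
  - apply: (int (fun w => szasz_indic (m n) x (X 0%N w))).
    apply: (@bounded_measurable_RV _ _ _ P X (szasz_indic (m n) x)).
    exact: bounded_measurable_szasz_indic.
  - apply: (int (fun w => \1_B (X 0%N w) : R)).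
    apply: (@bounded_measurable_RV _ _ _ P X (\1_B : R -> R)).
    exact: bounded_measurable_indic.
  rewrite (Rintegral_szasz_indic (m n) x_ge0 F_cdf); congr (_ - _).
  have mB : measurable (X 0%N @^-1` B) by exact: measurable_funPTI.
  rewrite /Rintegral -[RHS]/(fine (F x)%:E) -(PB 0) -[X in _ = fine (P X)]setIT.
  by rewrite -integral_indic.
have WE n : (0 < n)%N -> \int[P]_w (szasz_walk n w - bernoulli_walk n w) ^+ 2 =
    \int[P]_w (h n (X 0%N w) - c n) ^+ 2.
  move=> n0; have n0' : 0 < n%:R :> R by rewrite ltr0n.
  have q0 : 0 < Num.sqrt n%:R :> R by rewrite sqrtr_gt0.
  have bhc : bounded_measurable (fun y => h n y - c n).
    by apply: bounded_measurableB => //; exact: bounded_measurable_cst.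
  have hc0 : \int[P]_w (h n (X 0%N w) - c n) = 0.
    rewrite RintegralB//; last 2 first.
    - exact: int.
    - by apply: (int (fun=> c n)); exact: bounded_measurable_cst.
    by rewrite hc Rintegral_cst// fP1 mulr1 subrr.
  have /= V := Rintegral_sqr_sum X_indep X_idist n bhc hc0.
  transitivity (\int[P]_w (n%:R^-1 * (\sum_(i < n) (h n (X i w) - c n)) ^+ 2)).
    apply: eq_Rintegral => w _.
    have -> : szasz_walk n w - bernoulli_walk n w =
        (Num.sqrt n%:R)^-1 * \sum_(i < n) (h n (X i w) - c n).
      rewrite /szasz_walk /bernoulli_walk szasz_estimatorE// -mulr_suml.
      rewrite /h /c !sumrB !sumr_const !card_ord -(mulr_natl (F x))
        -(mulr_natl (szasz_operator _ _ _)).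
      move: (sqr_sqrtr (ltW n0')) q0; move: (Num.sqrt n%:R) => q <- q0.
      by field; rewrite gt_eqF.
    by rewrite exprMn exprVn sqr_sqrtr// ltW.
  rewrite RintegralZl// ?V; last first.
    apply: (int (fun w => (\sum_(i < n) (h n (X i w) - c n)) ^+ 2)).
    apply: bounded_measurable_sqr; apply: bounded_measurable_sum => i.
    by apply: bounded_measurableB => //; exact: bounded_measurable_cst.
  by rewrite mulrA mulVf ?mul1r// gt_eqF.
(* A variance is at most the second moment; the gap is [c n ^+ 2]. *)
have VE n : \int[P]_w (h n (X 0%N w) - c n) ^+ 2 <= \int[P]_w (h n (X 0%N w)) ^+ 2.
  have bc : bounded_measurable (fun w : T => 2 * c n * h n (X 0%N w) - c n ^+ 2).
    apply: bounded_measurableB; last exact: bounded_measurable_cst.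
    by apply: bounded_measurableM => //; exact: bounded_measurable_cst.
  have bh2 : bounded_measurable (fun w : T => h n (X 0%N w) ^+ 2).
    exact: bounded_measurable_sqr.
  rewrite (_ : \int[P]_w (h n (X 0%N w) - c n) ^+ 2 =
    \int[P]_w (h n (X 0%N w) ^+ 2 - (2 * c n * h n (X 0%N w) - c n ^+ 2))); last first.
    by apply: eq_Rintegral => w _; ring.
  rewrite RintegralB//; [|exact: int|exact: int].
  rewrite RintegralB//; last 2 first.
  - apply: (int (fun w : T => 2 * c n * h n (X 0%N w))).
    by apply: bounded_measurableM => //; exact: bounded_measurable_cst.
  - by apply: (int (fun=> c n ^+ 2)); exact: bounded_measurable_cst.
  rewrite RintegralZl//; last exact: int.
  rewrite hc Rintegral_cst// fP1 mulr1 gerBl (_ : _ - _ = c n ^+ 2) ?sqr_ge0//.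
  by ring.
have L2 := szasz_indic_L2 (X_ge0 0) F_cdf F_cont x_gt0 m_gt0 m_oo.
apply: (@squeeze_cvgr _ _ _ _ (cst 0)
  (fun n => \int[P]_w (h n (X 0%N w)) ^+ 2)) => //; last exact: cvg_cst.
near=> n; rewrite WE; last by near: n; exact: nbhs_infty_gt.
by rewrite VE andbT; apply: Rintegral_ge0 => w _; exact: sqr_ge0.
Unshelve. all: by end_near. Qed.

End szasz_clt.

(** * Comparison of an indicator with the smoothed indicators *)

Lemma dist_le_squeeze (R : realFieldType) (g u l un ln q eps : R) :
  `|g - u| < eps / 2 -> `|g - l| < eps / 2 ->
  `|u - un| < eps / 2 -> `|l - ln| < eps / 2 -> q <= un -> ln <= q ->
  `|g - q| <= eps.
Proof.
rewrite !ltr_norml => /andP[? ?] /andP[? ?] /andP[? ?] /andP[? ?] ? ?.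
by rewrite ler_norml; apply/andP; split; lra.
Qed.

Section smoothing.
Variables (R : realType) (s : R).
Hypothesis s0 : s != 0.
Local Notation G := (normal_cdf s).

Let sqrt_exprn4 (e : R) : Num.sqrt (e ^+ 4) = e ^+ 2.
Proof. by rewrite (exprM e 2 2) sqrtr_sqr ger0_norm ?sqr_ge0. Qed.

(* The time [e ^+ 4] makes [e] large compared with the width [e ^+ 2] of the
   smoothed indicator. *)
Lemma indic_le_heat (t e y z : R) : 0 < e ->
  \1_(`]-oo, t] : set R) z <=
  heat s (t + 2 * e) (e ^+ 4) y + (1 - G e^-1) + e ^- 2 * (z - y) ^+ 2.
Proof.
move=> e0; have e20 : 0 < e ^+ 2 by exact: exprn_gt0.
have sqe := sqrt_exprn4 e.
have G0 := normal_cdf_ge0 s.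
have G1 : 0 <= 1 - G e^-1 by rewrite subr_ge0 normal_cdf_le1.
have h0 : 0 <= heat s (t + 2 * e) (e ^+ 4) y by exact: normal_cdf_ge0.
have sq0 : 0 <= e ^- 2 * (z - y) ^+ 2 by rewrite mulr_ge0 ?sqr_ge0// invr_ge0 ltW.
rewrite indicE mem_setE in_itv/=; have [zt|_] := leP z t; last first.
  by rewrite /= addr_ge0// addr_ge0.
(* If y <= t + e, the argument of [G] is at least e / e^2 = 1/e. Otherwise y - z > e and the
   quadratic term alone exceeds 1, as in Chebyshev's inequality. *)
have [yt|ty] := leP y (t + e).
  rewrite (@le_trans _ _ (heat s (t + 2 * e) (e ^+ 4) y + (1 - G e^-1)))//; last by rewrite lerDl.
  rewrite addrCA lerDl subr_ge0 /heat sqe; apply: normal_cdf_nd => //.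
  rewrite ler_pdivlMr// (_ : e^-1 * e ^+ 2 = e); first lra.
  by field; rewrite gt_eqF.
rewrite (@le_trans _ _ (e ^- 2 * (z - y) ^+ 2))//; last first.
  by rewrite lerDr addr_ge0.
rewrite mulrC ler_pdivlMr// mul1r -(sqrrN (z - y)) opprB lerXn2r ?nnegrE//; lra.
Qed.

(** The mirror image of [indic_le_heat]. For z > t, either y <= t - e and the quadratic term is at
    least 1, or the argument of [G] is at most -1/e. *)
Lemma heat_le_indic (t e y z : R) : 0 < e ->
  heat s (t - 2 * e) (e ^+ 4) y - G (- e^-1) - e ^- 2 * (z - y) ^+ 2 <=
  \1_(`]-oo, t] : set R) z.
Proof.
move=> e0; have e20 : 0 < e ^+ 2 by exact: exprn_gt0.
have sqe := sqrt_exprn4 e.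
have H0 : heat s (t - 2 * e) (e ^+ 4) y <= 1 by exact: normal_cdf_le1.
have G0 : 0 <= G (- e^-1) by exact: normal_cdf_ge0.
have sq0 : 0 <= e ^- 2 * (z - y) ^+ 2 by rewrite mulr_ge0 ?sqr_ge0// invr_ge0 ltW.
rewrite indicE mem_setE in_itv/=; have [_|tz] := leP z t; first by rewrite /=; lra.
have [yt|ty] := leP y (t - e).
  have : 1 <= e ^- 2 * (z - y) ^+ 2; last by rewrite /=; lra.
  rewrite mulrC ler_pdivlMr// mul1r lerXn2r ?nnegrE//; lra.
have : heat s (t - 2 * e) (e ^+ 4) y <= G (- e^-1); last by rewrite /=; lra.
rewrite /heat sqe; apply: normal_cdf_nd => //.
rewrite ler_pdivrMr// mulNr (_ : e^-1 * e ^+ 2 = e); first lra.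
by field; rewrite gt_eqF.
Qed.

Lemma heat_shift_cvg (t c : R) :
  heat s (t + c * e) (e ^+ 4 + 1) 0 @[e --> 0^'+] --> G t.
Proof.
apply: cvg_at_right_filter; rewrite /heat.
have -> : G t = G ((t + c * 0 - 0) / Num.sqrt (0 ^+ 4 + 1)).
  by rewrite mulr0 addr0 subr0 expr0n/= add0r sqrtr1 divr1.
apply: continuous_cvg; first exact: continuous_normal_cdf.
apply: cvgM.
  apply: cvgB; last exact: cvg_cst.
  by apply: cvgD; [exact: cvg_cst|apply: cvgM; [exact: cvg_cst|exact: cvg_id]].
apply: cvgV; first by rewrite expr0n/= add0r sqrtr1.
apply: continuous_cvg; first exact: sqrt_continuous.
by apply: cvgD; [exact: exprn_continuous|exact: cvg_cst].
Qed.

Lemma inv_at_right_cvg : e^-1 @[e --> (0 : R)^'+] --> +oo.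
Proof.
apply/(gtr0_cvgV0 (f := fun e : R => e^-1)); first by near=> e; rewrite invr_gt0.
rewrite [X in X @ _ --> _](_ : _ = id); last by apply/funext => e; rewrite /= invrK.
exact: cvg_at_right_filter cvg_id.
Unshelve. all: by end_near. Qed.

End smoothing.

(** * From heat integrals to convergence of distribution functions *)

Section normal_limit_from_heat.
Context d (T : measurableType d) (R : realType) (P : probability T R).
Variables (Z W : nat -> T -> R) (s : R).
Hypotheses (s0 : s != 0) (bZ : forall n, bounded_measurable (Z n)).
Hypothesis bW : forall n, bounded_measurable (W n).
Hypothesis ZW : \int[P]_w (Z n w - W n w) ^+ 2 @[n --> \oo] --> (0 : R).
Hypothesis Wheat : forall a e, 0 < e ->
  \int[P]_w heat s a e (W n w) @[n --> \oo] --> heat s a (e + 1) 0.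
Local Notation G := (normal_cdf s).

(** The pointwise comparisons, taken at z = Z_n and y = W_n and integrated, enclose P(Z_n <= t)
    between quantities with limits in n; both limits tend to [G t] as e tends to 0. *)
Lemma cvg_normal_from_heat t :
  P (Z n @^-1` `]-oo, t]) @[n --> \oo] --> normal_prob 0 s `]-oo, t].
Proof.
have mZ n : measurable (Z n @^-1` `]-oo, t]).
  by have [mZn _] := bZ n; rewrite -[X in measurable X]setTI; exact: mZn.
have bheat a e n : bounded_measurable (fun w => heat s a e (W n w)).
  apply: (@bounded_measurable_comp _ _ _ _ _ (W n) (heat s a e)); first by have [] := bW n.
  exact: bounded_measurable_heat.
have bsq n : bounded_measurable (fun w => (Z n w - W n w) ^+ 2).
  by apply: bounded_measurable_sqr; exact: bounded_measurableB.
have bI n : bounded_measurable (fun w => \1_(`]-oo, t] : set R) (Z n w) : R).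
  apply: (@bounded_measurable_comp _ _ _ _ _ (Z n) (\1_(`]-oo, t] : set R) : R -> R)).
    by have [] := bZ n.
  exact: bounded_measurable_indic.
have int (f : T -> R) : bounded_measurable f -> P.-integrable setT (EFin \o f).
  by move=> ?; exact: bounded_measurable_integrable.
have fP1 : fine (P setT) = 1 by rewrite probability_setT.
have PI n : fine (P (Z n @^-1` `]-oo, t])) = \int[P]_w \1_(`]-oo, t] : set R) (Z n w).
  by rewrite /Rintegral -[X in fine (P X)]setIT -integral_indic.
have upper n e : 0 < e -> fine (P (Z n @^-1` `]-oo, t])) <=
    \int[P]_w heat s (t + 2 * e) (e ^+ 4) (W n w) + (1 - G e^-1) +
    e ^- 2 * \int[P]_w (Z n w - W n w) ^+ 2.
  move=> e0; have b1 : bounded_measurable (fun w =>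
      heat s (t + 2 * e) (e ^+ 4) (W n w) + (1 - G e^-1)).
    by apply: bounded_measurableD => //; exact: bounded_measurable_cst.
  have b2 : bounded_measurable (fun w => e ^- 2 * (Z n w - W n w) ^+ 2).
    by apply: bounded_measurableM => //; exact: bounded_measurable_cst.
  rewrite PI; apply: (@le_trans _ _ (\int[P]_w
    (heat s (t + 2 * e) (e ^+ 4) (W n w) + (1 - G e^-1) +
    e ^- 2 * (Z n w - W n w) ^+ 2))).
    apply: le_Rintegral => //; [exact: int|by apply: int; exact: bounded_measurableD|].
    by move=> w _; exact: indic_le_heat.
  rewrite RintegralD//; [|exact: int|exact: int].
  rewrite RintegralD//; [|exact: int|
    by apply: (int (fun=> 1 - G e^-1)); exact: bounded_measurable_cst].
  by rewrite RintegralZl ?Rintegral_cst ?fP1 ?mulr1//; exact: int.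
have lower n e : 0 < e ->
    \int[P]_w heat s (t - 2 * e) (e ^+ 4) (W n w) - G (- e^-1) -
    e ^- 2 * \int[P]_w (Z n w - W n w) ^+ 2 <= fine (P (Z n @^-1` `]-oo, t])).
  move=> e0; have b1 : bounded_measurable (fun w =>
      heat s (t - 2 * e) (e ^+ 4) (W n w) - G (- e^-1)).
    by apply: bounded_measurableB => //; exact: bounded_measurable_cst.
  have b2 : bounded_measurable (fun w => e ^- 2 * (Z n w - W n w) ^+ 2).
    by apply: bounded_measurableM => //; exact: bounded_measurable_cst.
  rewrite PI; apply: (@le_trans _ _ (\int[P]_w
    (heat s (t - 2 * e) (e ^+ 4) (W n w) - G (- e^-1) -
    e ^- 2 * (Z n w - W n w) ^+ 2))); last first.
    apply: le_Rintegral => //; [by apply: int; exact: bounded_measurableB|exact: int|].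
    by move=> w _; exact: heat_le_indic.
  rewrite RintegralB//; [|exact: int|exact: int].
  rewrite RintegralB//; [|exact: int|
    by apply: (int (fun=> G (- e^-1))); exact: bounded_measurable_cst].
  by rewrite RintegralZl ?Rintegral_cst ?fP1 ?mulr1//; exact: int.
rewrite normal_cdfE//; apply/cvg_EFin.
  by apply: nearW => n; exact: fin_num_measure.
have invy := @inv_at_right_cvg R.
have GV1 : G e^-1 @[e --> 0^'+] --> (1 : R) by apply: (cvg_comp _ _ invy); exact: normal_cdf_cvg1.
have GV0 : G (- e^-1) @[e --> 0^'+] --> (0 : R).
  apply: (@cvg_comp _ _ _ _ G _ -oo); last exact: normal_cdf_cvg0.
  by apply/cvgNrNy.
have U : heat s (t + 2 * e) (e ^+ 4 + 1) 0 + (1 - G e^-1) @[e --> 0^'+] --> G t.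
  rewrite (_ : G t = G t + (1 - 1)); last by rewrite subrr addr0.
  apply: cvgD; first exact: heat_shift_cvg.
  by apply: cvgB => //; exact: cvg_cst.
have L : heat s (t - 2 * e) (e ^+ 4 + 1) 0 - G (- e^-1) @[e --> 0^'+] --> G t.
  rewrite -[X in _ --> X]subr0; apply: cvgB => //.
  under eq_cvg do rewrite -mulNr; exact: heat_shift_cvg.
apply/cvgrPdist_le => eps eps0.
have eps2 : 0 < eps / 2 by rewrite divr_gt0.
(* The width e is fixed before n, so the large factor [e ^- 2] stays constant while the mean square
   distance it multiplies tends to 0. *)
have [e [e0 Ue Le]] : exists e, [/\ 0 < e,
    `|G t - (heat s (t + 2 * e) (e ^+ 4 + 1) 0 + (1 - G e^-1))| < eps / 2 &
    `|G t - (heat s (t - 2 * e) (e ^+ 4 + 1) 0 - G (- e^-1))| < eps / 2].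
  near (0 : R)^'+ => e; exists e; split; first by [].
    by near: e; move/cvgrPdist_lt : U; exact.
  by near: e; move/cvgrPdist_lt : L; exact.
have e40 : 0 < e ^+ 4 by exact: exprn_gt0.
have ZWe : e ^- 2 * \int[P]_w (Z n w - W n w) ^+ 2 @[n --> \oo] --> (0 : R).
  by rewrite -[X in _ --> X](mulr0 (e ^- 2)); apply: cvgM => //; exact: cvg_cst.
have Un : \int[P]_w heat s (t + 2 * e) (e ^+ 4) (W n w) + (1 - G e^-1) +
    e ^- 2 * \int[P]_w (Z n w - W n w) ^+ 2 @[n --> \oo] -->
    heat s (t + 2 * e) (e ^+ 4 + 1) 0 + (1 - G e^-1).
  rewrite -[X in _ --> X]addr0; apply: cvgD => //.
  by apply: cvgD; [exact: Wheat|exact: cvg_cst].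
have Ln : \int[P]_w heat s (t - 2 * e) (e ^+ 4) (W n w) - G (- e^-1) -
    e ^- 2 * \int[P]_w (Z n w - W n w) ^+ 2 @[n --> \oo] -->
    heat s (t - 2 * e) (e ^+ 4 + 1) 0 - G (- e^-1).
  rewrite -[X in _ --> X]subr0; apply: cvgB => //.
  by apply: cvgB; [exact: Wheat|exact: cvg_cst].
near=> n; apply: (dist_le_squeeze Ue Le _ _ (upper n e e0) (lower n e e0)).
  by near: n; move/cvgrPdist_lt : Un; exact.
by near: n; move/cvgrPdist_lt : Ln; exact.
Unshelve. all: by end_near. Qed.

End normal_limit_from_heat.

(** * Mean and normal limit of the Szasz estimator *)

Theorem theorem5 (R : realType) (d : measure_display) (T : measurableType d)
    (P : probability T R) (X : nat -> {RV P >-> R}) (F f f' : R -> R)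
    (X_indep : mutually_independent X)
    (X_idist : identically_distributed X)
    (X_ge0 : forall i w, 0 <= X i w)
    (F_cdf : forall y, cdf (X 0%N) y = (F y)%:E)
    (F0 : F 0 = 0)
    (F_cont : continuous F)
    (F_deriv : forall y, 0 <= y -> has_derivative_within `[0, +oo[%classic F y (f y))
    (f_deriv : forall y, 0 <= y -> has_derivative_within `[0, +oo[%classic f y (f' y))
    (f_cont : {within `[0, +oo[, continuous f})
    (f_bounded : [bounded f y | y in `[0, +oo[])
    (f'_cont : {within `[0, +oo[, continuous f'})
    (f'_bounded : [bounded f' y | y in `[0, +oo[])
    (m : nat -> nat)
    (m_gt0 : forall n, (0 < n)%N -> (0 < m n)%N)
    (m_oo : m n @[n --> \oo] --> \oo)
    (x : R) (x_gt0 : 0 < x) (Fx_gt0 : 0 < F x) (Fx_lt1 : F x < 1) :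
  let Fhat n w := szasz_estimator X (m n) n x w in
  [/\ forall n, (0 < n)%N ->
        ('E_P[Fhat n] = (szasz_operator (m n) F x)%:E)%E,
      forall n w, (0 < n)%N ->
        Num.sqrt n%:R * (Fhat n w - fine 'E_P[Fhat n]%E) =
        Num.sqrt n%:R * (Fhat n w - szasz_operator (m n) F x) &
      cvg_in_distribution P
        (fun n w => Num.sqrt n%:R * (Fhat n w - fine 'E_P[Fhat n]%E))
        (normal_prob 0 (Num.sqrt (F x * (1 - F x))))].
Proof.
move=> Fhat.
have EF n : (0 < n)%N -> ('E_P[Fhat n] = (szasz_operator (m n) F x)%:E)%E.
  move=> n0; have bF := @bounded_measurable_szasz_estimator _ _ _ P X x m x_gt0 n.
  rewrite unlock -(Rintegral_szasz_estimator m X_idist F_cdf x_gt0 n0) fineK//.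
  apply: integrable_fin_num => //.
  exact: (bounded_measurable_integrable P measurableT bF).
split=> [//|n w n0|]; first by rewrite EF.
have -> : (fun n w => Num.sqrt n%:R * (Fhat n w - fine 'E_P[Fhat n]%E)) =
    szasz_walk X F x m.
  (* For [n = 0] the estimator is 0 and its mean need not be [szasz_operator (m 0) F x], but the
     factor [Num.sqrt 0] makes both sides zero. *)
  apply/funext => -[|n]; apply/funext => w.
    by rewrite /szasz_walk sqrtr0 !mul0r.
  by rewrite /szasz_walk EF.
have bZ := @bounded_measurable_szasz_walk _ _ _ P X F x m x_gt0.
split=> [n|t _]; first by have [] := bZ n.
apply: (@cvg_normal_from_heat _ _ _ P _ (bernoulli_walk X F x)) => //.
- by rewrite gt_eqF// sqrtr_gt0 mulr_gt0// subr_gt0.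
- exact: bounded_measurable_bernoulli_walk.
- by apply: szasz_walk_L2 => //; exact: F_cont.
- by move=> a e e0; exact: bernoulli_walk_heat.
Qed.
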